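(* Let $\mathbb{F}$ be an algebraically closed field, let $n\geq 2$, and let $1\leq s\leq n+1$ be an integer. Then for generic maximal tori $\tilde T_1,\dots,\tilde T_s$ of $\mathrm{PGL}_n(\mathbb{F})$, we have \[\dim(\tilde T_1\cdots \tilde T_s)=\sum_{i=1}^s \dim(\tilde T_i).\] In particular, for such tori, generic elements $g\in\tilde T_1\cdots\tilde T_s$ have only finitely many decompositions of the form $g=t_1\cdots t_s$ with $t_i\in\tilde T_i$.
   Context: $\mathrm{PGL}_n(\mathbb{F})=\mathrm{GL}_n(\mathbb{F})/\{\lambda I_n:\lambda\in\mathbb{F}^\times\}$, regarded as an algebraic group $G$ over $\mathbb{F}$. For subsets $A_1,\dots,A_s$ of $G$, the product $A_1\cdots A_s$ is $\{a_1\cdots a_s: a_i\in A_i\}$. For a constructible subset $A$ of a variety, $\dim(A)$ means the dimension of its Zariski closure $\overline{A}$. Generic maximal tori: fix a maximal torus $T$ of $G$. Maximal tori of $G$ are exactly the conjugates $T^g=g^{-1}Tg$, $g\in G$, and they are parametrised bijectively by the variety $\mathcal{T}=\{N_G(T)g: g\in G\}$ of right cosets of the normaliser $N_G(T)$. A statement holds for generic maximal tori $\tilde T_1,\dots,\tilde T_s$ if there is a nonempty Zariski open subset $U$ of $\mathcal{T}^s$ such that it holds for all $(\tilde T_1,\dots,\tilde T_s)\in U$. Generic elements: a statement holds for generic elements of a constructible set $A$ with irreducible closure if it holds for all elements of some nonempty subset of $A$ that is open in $\overline{A}$. *)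

(* Defs.v *)
From HB Require Import structures.
From mathcomp Require Import -(notations) mpoly.
From mathcomp Require Import all_boot all_order all_algebra.
From mathcomp Require Import all_classical topology.

Set Implicit Arguments.
Unset Strict Implicit.
Unset Printing Implicit Defensive.

Import GRing.Theory.
Local Open Scope classical_set_scope.
Local Open Scope ring_scope.
Local Open Scope quotient_scope.

(** Affine space with coordinates indexed by a finite type [J]. The alias keeps
    the Zariski topology below apart from the library's topologies on
    function types. *)

Definition affine (F : fieldType) (J : finType) : Type := J -> F.

Section Affine.
Context {F : fieldType} {J : finType}.
Implicit Types (p q : mpoly #|J| F) (x : affine F J).

HB.instance Definition _ := Choice.copy (affine F J) (J -> F).

Definition peval p x : F := meval (fun k => x (enum_val k)) p.

Lemma pevalM p q x : peval (p * q) x = peval p x * peval q x.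
Proof. exact: mevalM. Qed.

Lemma peval1 x : peval 1 x = 1.
Proof. exact: meval1. Qed.

Definition zariski_open (U : set (affine F J)) : Prop :=
  exists S : set (mpoly #|J| F),
    U = [set x | exists2 p, S p & peval p x != 0].

Let zopenT : zariski_open setT.
Proof.
exists [set 1]; rewrite eqEsubset; split=> // x _ /=; exists 1 => //.
by rewrite peval1 oner_neq0.
Qed.

Let zopenI : setI_closed zariski_open.
Proof.
move=> _ _ [S ->] [S' ->].
exists [set r | exists p q, [/\ S p, S' q & r = p * q]].
rewrite eqEsubset; split=> [x [[p Sp px] [q S'q qx]]|x [_ [p [q [Sp S'q ->]]]]].
  by exists (p * q); [exists p, q | rewrite pevalM mulf_neq0].
by rewrite pevalM mulf_eq0 negb_or => /andP[px qx]; split; [exists p|exists q].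
Qed.

Let zopen_bigU (I : Type) (f : I -> set (affine F J)) :
  (forall i, zariski_open (f i)) -> zariski_open (\bigcup_i f i).
Proof.
move=> /choice[S fE]; exists (\bigcup_i S i).
rewrite eqEsubset; split=> x [].
  by move=> i _; rewrite fE => -[p Sp px]; exists p => //; exists i.
by move=> p [i _ Sp] px; exists i => //; rewrite fE; exists p.
Qed.

HB.instance Definition _ :=
  isOpenTopological.Build (affine F J) zopenT zopenI zopen_bigU.

End Affine.

Record GL (F : fieldType) (n : nat) := MkGL {
  GLmx :> 'M[F]_n;
  GLunit : GLmx \in unitmx
}.

Section GLGroup.
Context {F : fieldType} {n : nat}.

HB.instance Definition _ := [isSub for @GLmx F n].
HB.instance Definition _ := [Choice of GL F n by <:].

Implicit Types A B C : GL F n.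

Lemma GL1_subproof : 1%:M \in @unitmx F n.
Proof. exact: unitmx1. Qed.

Lemma GLM_subproof A B : A *m B \in unitmx.
Proof. by rewrite unitmx_mul !GLunit. Qed.

Lemma GLV_subproof A : invmx A \in unitmx.
Proof. by rewrite unitmx_inv GLunit. Qed.

Definition GL1 : GL F n := MkGL GL1_subproof.
Definition GLM A B : GL F n := MkGL (GLM_subproof A B).
Definition GLV A : GL F n := MkGL (GLV_subproof A).

Let GLMA : associative GLM.
Proof. by move=> A B C; apply: val_inj; rewrite /= mulmxA. Qed.

Let GL1M : left_id GL1 GLM.
Proof. by move=> A; apply: val_inj; rewrite /= mul1mx. Qed.

Let GLM1 : right_id GL1 GLM.
Proof. by move=> A; apply: val_inj; rewrite /= mulmx1. Qed.

Let GLVM : left_inverse GL1 GLV GLM.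
Proof. by move=> A; apply: val_inj; rewrite /= mulVmx ?GLunit. Qed.

Let GLMV : right_inverse GL1 GLV GLM.
Proof. by move=> A; apply: val_inj; rewrite /= mulmxV ?GLunit. Qed.

HB.instance Definition _ := isGroup.Build (GL F n) GLMA GL1M GLM1 GLVM GLMV.

Definition GLentries A : affine F ('I_n * 'I_n)%type := fun ij => A ij.1 ij.2.

HB.instance Definition _ :=
  Topological.copy (GL F n) (initial_topology GLentries).

Definition scalar_rel : rel (GL F n) :=
  fun A B => `[< exists2 c : F, c != 0 & GLmx A = c *: GLmx B >].

Lemma scalar_relP A B :
  reflect (exists2 c : F, c != 0 & GLmx A = c *: GLmx B) (scalar_rel A B).
Proof. exact: asboolP. Qed.

Let scalar_refl : reflexive scalar_rel.
Proof.
by move=> A; apply/scalar_relP; exists 1; rewrite ?oner_neq0 ?scale1r.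
Qed.

Let scalar_sym : symmetric scalar_rel.
Proof.
suff H A B : scalar_rel A B -> scalar_rel B A by move=> A B; apply/idP/idP => /H.
move=> /scalar_relP[c c0 AB]; apply/scalar_relP.
by exists c^-1; rewrite ?invr_neq0 // AB scalerA mulVf // scale1r.
Qed.

Let scalar_trans : transitive scalar_rel.
Proof.
move=> B A C /scalar_relP[c c0 AB] /scalar_relP[d d0 BC]; apply/scalar_relP.
by exists (c * d); rewrite ?mulf_neq0 // AB BC scalerA.
Qed.

Canonical scalar_equiv := EquivRel scalar_rel scalar_refl scalar_sym scalar_trans.

End GLGroup.

(** The projection from GL_n to the variety PGL_n is open, so the Zariski
    topology of PGL_n is the quotient topology. *)

Definition PGL (F : fieldType) (n : nat) : Type :=
  quotient_topology {eq_quot (@scalar_equiv F n)}.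

Section PGLGroup.
Context {F : fieldType} {n : nat}.
Local Notation G := (PGL F n).

HB.instance Definition _ := Topological.on G.
HB.instance Definition _ := Quotient.on G.

Definition toPGL (A : GL F n) : G := \pi_G A.

Lemma toPGL_eqP (A B : GL F n) :
  toPGL A = toPGL B <-> exists2 c : F, c != 0 & GLmx A = c *: GLmx B.
Proof.
split=> [/eqmodP/scalar_relP //|AB].
by apply/eqmodP/scalar_relP.
Qed.

Lemma toPGL_repr (x : G) : toPGL (repr x) = x.
Proof. exact: reprK. Qed.

Definition PGL1 : G := toPGL 1%g.
Definition PGLM (x y : G) : G := toPGL (repr x * repr y)%g.
Definition PGLV (x : G) : G := toPGL (repr x)^-1%g.

Let toPGLM' (A B : GL F n) : toPGL (A * B)%g = PGLM (toPGL A) (toPGL B).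
Proof.
have /toPGL_eqP[c c0 Ac] : toPGL A = toPGL (repr (toPGL A)) by rewrite toPGL_repr.
have /toPGL_eqP[d d0 Bd] : toPGL B = toPGL (repr (toPGL B)) by rewrite toPGL_repr.
apply/toPGL_eqP; exists (c * d); first by rewrite mulf_neq0.
by rewrite /= Ac Bd -scalemxAl -scalemxAr scalerA.
Qed.

Let toPGLV' (A : GL F n) : toPGL A^-1%g = PGLV (toPGL A).
Proof.
have /toPGL_eqP[c c0 Ac] : toPGL A = toPGL (repr (toPGL A)) by rewrite toPGL_repr.
apply/toPGL_eqP; exists c^-1; first by rewrite invr_neq0.
by rewrite /= Ac invmxZ // ?unitmxZ ?GLunit ?unitfE.
Qed.

Let PGLMA : associative PGLM.
Proof.
move=> x y z; rewrite -[x]toPGL_repr -[y]toPGL_repr -[z]toPGL_repr.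
by rewrite -!toPGLM' mulgA.
Qed.

Let PGL1M : left_id PGL1 PGLM.
Proof. by move=> x; rewrite -[x]toPGL_repr -toPGLM' mul1g. Qed.

Let PGLM1 : right_id PGL1 PGLM.
Proof. by move=> x; rewrite -[x]toPGL_repr -toPGLM' mulg1. Qed.

Let PGLVM : left_inverse PGL1 PGLV PGLM.
Proof. by move=> x; rewrite -[x]toPGL_repr -toPGLV' -toPGLM' mulVg. Qed.

Let PGLMV : right_inverse PGL1 PGLV PGLM.
Proof. by move=> x; rewrite -[x]toPGL_repr -toPGLV' -toPGLM' mulgV. Qed.

HB.instance Definition _ := isGroup.Build G PGLMA PGL1M PGLM1 PGLVM PGLMV.

Lemma toPGLM (A B : GL F n) : toPGL (A * B)%g = (toPGL A * toPGL B)%g.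
Proof. by rewrite toPGLM'. Qed.

Lemma toPGLV (A : GL F n) : toPGL A^-1%g = (toPGL A)^-1%g.
Proof. by rewrite toPGLV'. Qed.

End PGLGroup.

Section Dimension.
Context {X : topologicalType}.
Implicit Types A : set X.

Definition irreducible_set (Z : set X) : Prop :=
  Z !=set0 /\
  forall C D, closed C -> closed D -> Z `<=` C `|` D -> Z `<=` C \/ Z `<=` D.

Definition irreducible_chain A (d : nat) (Z : nat -> set X) : Prop :=
  (forall i, (i <= d)%N ->
     [/\ Z i `<=` closure A, closed (Z i) & irreducible_set (Z i)]) /\
  (forall i, (i < d)%N -> Z i `<` Z i.+1).

(** [has_dim A d] : the Zariski closure of [A] has (finite) Krull dimension
    [d]. It holds for no [d] if [A] is empty or of infinite dimension. *)
Definition has_dim A (d : nat) : Prop :=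
  (exists Z, irreducible_chain A d Z) /\
  (forall d' Z, irreducible_chain A d' Z -> (d' <= d)%N).

(** [P] holds for generic elements of [A]; meant for [A] constructible with
    irreducible closure. *)
Definition generically A (P : X -> Prop) : Prop :=
  exists W : set X,
    [/\ W !=set0, W `<=` A, exists2 V, open V & W = V `&` closure A
      & forall x, W x -> P x].

End Dimension.

Section Tori.
Context {F : fieldType} {n : nat}.
Local Notation G := (PGL F n).
Implicit Types T : set G.

(** Regular functions on the affine variety PGL_n are the functions on GL_n in
    F[x_ij, 1/det] that are constant modulo scalars. *)
Definition regular_PGL (f : G -> F) : Prop :=
  exists (p : mpoly #|{: 'I_n * 'I_n}| F) (k : nat),
    forall A : GL F n, f (toPGL A) = peval p (GLentries A) / \det A ^+ k.

(** Only the restriction of [f] to [T] matters. *)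
Definition regular_on T (f : G -> F) : Prop :=
  exists2 g, regular_PGL g & forall x, T x -> f x = g x.

(** The split torus G_m^r, as the open subset of affine r-space where no
    coordinate vanishes, and its ring of regular functions. *)
Definition Gm (r : nat) : set ('I_r -> F) := [set x | forall i, x i != 0].

Definition regular_Gm (r : nat) (f : ('I_r -> F) -> F) : Prop :=
  exists (p : mpoly #|{: 'I_r}| F) (k : nat),
    forall x, Gm x -> f x = peval p (x : affine F 'I_r) / (\prod_i x i) ^+ k.

Definition subgroup T : Prop :=
  [/\ T 1%g, forall x y, T x -> T y -> T (x * y)%g
    & forall x, T x -> T x^-1%g].

(** A bijection between affine varieties is an isomorphism iff it identifies
    their rings of regular functions. *)
Definition torus_iso (r : nat) (phi : ('I_r -> F) -> G) T : Prop :=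
  [/\ set_bij (Gm (r:=r)) T phi,
      forall x y, Gm x -> Gm y -> phi (fun i => x i * y i) = (phi x * phi y)%g
    & forall f : G -> F, regular_on T f <-> regular_Gm (f \o phi)].

Definition is_torus T : Prop :=
  [/\ subgroup T, closed T & exists r (phi : ('I_r -> F) -> G), torus_iso phi T].

Definition maximal_torus T : Prop :=
  is_torus T /\ forall T', is_torus T' -> T `<=` T' -> T' = T.

Definition conj_set T (g : G) : set G := [set (t ^ g)%g | t in T].

Definition normaliser T : set G := [set g | conj_set T g = T].

Definition rcoset (N : set G) (g : G) : set G := [set (x * g)%g | x in N].

(** Zariski-open subsets of the variety G^s, which carries the quotient
    topology from GL_n^s (not the product topology of the factors). *)
Definition open_pow (s : nat) (U : set ('I_s -> G)) : Prop :=
  exists2 V : set (affine F ('I_s * ('I_n * 'I_n))%type), open V &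
    forall A : 'I_s -> GL F n,
      U (fun i => toPGL (A i)) <-> V (fun z => GLentries (A z.1) z.2).

(** The s-th power of the variety of right cosets of [normaliser T], and its
    open subsets: those with open preimage in G^s. *)
Definition coset_pow T (s : nat) : set ('I_s -> set G) :=
  [set C | forall i, exists g, C i = rcoset (normaliser T) g].

Definition open_coset_pow T (s : nat) (U : set ('I_s -> set G)) : Prop :=
  U `<=` coset_pow T (s:=s) /\
  open_pow [set g : 'I_s -> G | U (fun i => rcoset (normaliser T) (g i))].

(** [P] holds for generic maximal tori, the coset N_G(T)g corresponding to the
    torus T^g. *)
Definition generic_tori T (s : nat) (P : ('I_s -> set G) -> Prop) : Prop :=
  exists U : set ('I_s -> set G),
    [/\ open_coset_pow T U, U !=set0
      & forall g : 'I_s -> G,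
          U (fun i => rcoset (normaliser T) (g i)) ->
          P (fun i => conj_set T (g i))].

Definition decompositions (s : nat) (Ts : 'I_s -> set G) (g : G) :
    set ('I_s -> G) :=
  [set t | (forall i, Ts i (t i)) /\ g = (\prod_(i < s) t i)%g].

Definition prod_set (s : nat) (Ts : 'I_s -> set G) : set G :=
  [set g | decompositions Ts g !=set0].

End Tori.

(* Main.v *)
(** The tangent space at 1 of a product of tori is the sum of their Lie
    algebras, so it suffices that these be independent modulo scalars. This is
    an open condition on the tuple of tori, and in every characteristic it holds
    for the diagonal torus together with its conjugates by
    [1 + \sum_(b != k) E_kb], one for each row [k].

    Everything is carried out with polynomial functions on the cones over
    subsets of [PGL], that is, on their preimages in [GL]. Independent tangent
    vectors make suitable linear forms algebraically independent on the cone
    over the image of a parametrisation (look at the lowest order term at 1),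
    whereas more polynomial functions than variables are always algebraically
    dependent. Comparing the two bounds chains of irreducible closed sets from
    above, shows that the images of the coordinate subtori form a strict chain,
    and yields finite generic fibres. Chevalley's theorem, obtained from
    quantifier elimination, provides an open subset of the closure inside the
    product. Finally, a torus of [PGL_n] lifts to a group of commuting matrices
    and is diagonalisable, so maximal tori are conjugates of the diagonal one. *)

Require Import Defs.
From mathcomp Require Import -(notations) mpoly.
From mathcomp Require Import all_boot all_order all_algebra all_field.
From mathcomp Require Import all_classical topology.
From mathcomp Require Import ring.

Set Implicit Arguments.
Unset Strict Implicit.
Unset Printing Implicit Defensive.

Import GRing.Theory.
Local Open Scope classical_set_scope.
Local Open Scope ring_scope.

(** * Polynomial functions *)

Section PolynomialFunctions.
Variable F : closedFieldType.

(** The bound on [s] is the dimension count: PGL_n has dimension n^2 - 1 = (n + 1)(n - 1), so n + 1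
    tori of dimension n - 1 just fit. Two obstacles shape the proof. PGL has no global coordinates,
    so scaling is treated as one more parameter, indexed by [None], with tangent vector 1;
    independence modulo scalars then becomes plain independence of a family indexed by [option J].
    And in positive characteristic algebraic independence need not show in derivatives; the proof
    uses only the implication from independent derivatives to algebraic independence, which orders
    of vanishing along lines give in every characteristic. Polynomials enter as functions on
    arbitrary index types, so that substitution is composition; this loses nothing because an
    algebraically closed field is infinite. *)

Inductive polyfun (I : Type) : ((I -> F) -> F) -> Prop :=
| polyfun_cst c : polyfun (fun=> c)
| polyfun_var i : polyfun (fun x => x i)
| polyfun_add f g : polyfun f -> polyfun g -> polyfun (fun x => f x + g x)
| polyfun_mul f g : polyfun f -> polyfun g -> polyfun (fun x => f x * g x).

Definition upoly (f : F -> F) := exists p : {poly F}, forall t, f t = p.[t].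

(** The index [None] marks the distinguished variable: the one expanded in, or the scaling parameter
    of a cone. *)
Definition ocons (I : Type) (t : F) (x : I -> F) : option I -> F := oapp x t.

Lemma oconsE (I : Type) (z : option I -> F) : z = ocons (z None) (z \o Some).
Proof. by apply/funext => -[]. Qed.

Lemma polyfun_ext (I : Type) (f g : (I -> F) -> F) :
  f =1 g -> polyfun f -> polyfun g.
Proof. by move=> /funext ->. Qed.

Lemma polyfun_sum (I : Type) (K : Type) (s : seq K) (P : pred K)
    (f : K -> (I -> F) -> F) :
  (forall k, polyfun (f k)) -> polyfun (fun x => \sum_(k <- s | P k) f k x).
Proof.
move=> fP; elim: s => [|k s IH].
  by apply: polyfun_ext (polyfun_cst _ 0) => x; rewrite big_nil.
case Pk : (P k).
  by apply: polyfun_ext (polyfun_add (fP k) IH) => x; rewrite big_cons Pk.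
by apply: polyfun_ext IH => x; rewrite big_cons Pk.
Qed.

Lemma polyfun_prod (I : Type) (K : Type) (s : seq K) (P : pred K)
    (f : K -> (I -> F) -> F) :
  (forall k, polyfun (f k)) -> polyfun (fun x => \prod_(k <- s | P k) f k x).
Proof.
move=> fP; elim: s => [|k s IH].
  by apply: polyfun_ext (polyfun_cst _ 1) => x; rewrite big_nil.
case Pk : (P k).
  by apply: polyfun_ext (polyfun_mul (fP k) IH) => x; rewrite big_cons Pk.
by apply: polyfun_ext IH => x; rewrite big_cons Pk.
Qed.

Lemma polyfun_exp (I : Type) (f : (I -> F) -> F) k :
  polyfun f -> polyfun (fun x => f x ^+ k).
Proof.
move=> fP; apply: polyfun_ext (polyfun_prod (index_enum 'I_k) xpredT (fun=> fP)).
by move=> x; rewrite big_const card_ord iter_mulr_1.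
Qed.

Lemma polyfun_opp (I : Type) (f : (I -> F) -> F) :
  polyfun f -> polyfun (fun x => - f x).
Proof.
move=> fP; apply: polyfun_ext (polyfun_mul (polyfun_cst _ (-1)) fP) => x.
by rewrite mulN1r.
Qed.

Lemma polyfun_sub (I : Type) (f g : (I -> F) -> F) :
  polyfun f -> polyfun g -> polyfun (fun x => f x - g x).
Proof. by move=> fP /polyfun_opp; apply: polyfun_add. Qed.

Lemma polyfun_comp (I I' : Type) (P : (I' -> F) -> F) (u : (I -> F) -> I' -> F) :
  polyfun P -> (forall a, polyfun (fun x => u x a)) -> polyfun (fun x => P (u x)).
Proof.
move=> PP uP; elim: PP => [c|a|f g _ fP _ gP|f g _ fP _ gP].
- exact: polyfun_cst.
- exact: uP.
- exact: polyfun_add.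
- exact: polyfun_mul.
Qed.

Lemma polyfun_curve (I : Type) (P : (I -> F) -> F) (u : F -> I -> F) :
  polyfun P -> (forall a, upoly (u^~ a)) -> upoly (fun t => P (u t)).
Proof.
move=> PP uP; elim: PP => [c|a|f g _ [p fE] _ [q gE]|f g _ [p fE] _ [q gE]].
- by exists c%:P => t; rewrite hornerC.
- exact: uP.
- by exists (p + q) => t; rewrite hornerD fE gE.
- by exists (p * q) => t; rewrite hornerM fE gE.
Qed.

Lemma upoly_affine (a b : F) : upoly (fun t => a + t * b).
Proof. by exists (a%:P + 'X * b%:P) => t; rewrite !hornerE. Qed.

Lemma upoly_nz2 (f g : F -> F) s t : upoly f -> upoly g ->
  f s != 0 -> g t != 0 -> exists r, f r != 0 /\ g r != 0.
Proof.
move=> [p fE] [q gE]; rewrite fE gE => ps qt.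
have p0 : p != 0 by apply: contra_neq ps => ->; rewrite horner0.
have q0 : q != 0 by apply: contra_neq qt => ->; rewrite horner0.
have /closed_nonrootP[r] : p * q != 0 by rewrite mulf_neq0.
by rewrite rootM negb_or => /andP[pr qr]; exists r; rewrite fE gE.
Qed.

Lemma upoly_eq0 (f : F -> F) : upoly f -> (forall t, t != 0 -> f t = 0) ->
  forall t, f t = 0.
Proof.
move=> fP f0 t; apply/eqP/negP => /negP ft.
have idP : upoly id by exists 'X => r; rewrite hornerX.
have [r [fr r0]] := upoly_nz2 fP idP ft (oner_neq0 F).
by rewrite f0 ?eqxx in fr.
Qed.

Lemma polyfun_nz2 (I : Type) (f g : (I -> F) -> F) x y :
  polyfun f -> polyfun g -> f x != 0 -> g y != 0 ->
  exists z, f z != 0 /\ g z != 0.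
Proof.
move=> fP gP fx gy; pose u (t : F) i := x i + t * (y i - x i).
have uP a : upoly (u^~ a) by exact: upoly_affine.
have u0 : u 0 = x by apply/funext => i; rewrite /u mul0r addr0.
have u1 : u 1 = y by apply/funext => i; rewrite /u mul1r addrC subrK.
rewrite -u0 in fx; rewrite -u1 in gy.
have [t ft] := upoly_nz2 (polyfun_curve fP uP) (polyfun_curve gP uP) fx gy.
by exists (u t).
Qed.

Definition nonvanishing (I : Type) (x : I -> F) := forall i, x i != 0.

Lemma polyfun_nz (I : finType) (f : (I -> F) -> F) x :
  polyfun f -> f x != 0 -> exists2 z, nonvanishing z & f z != 0.
Proof.
move=> fP fx.
have gP : polyfun (fun x : I -> F => \prod_i x i).
  by apply: polyfun_prod => i; apply: polyfun_var.
have g1 : \prod_(i : I) (fun=> 1 : F) i != 0 by rewrite big1 ?oner_neq0.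
have [z [fz gz]] := polyfun_nz2 fP gP fx g1.
exists z => // i; apply: contra_neq gz => zi.
by rewrite (bigD1 i) //= zi mul0r.
Qed.

Lemma polyfun_eq0 (I : finType) (f : (I -> F) -> F) :
  polyfun f -> (forall x, nonvanishing x -> f x = 0) -> forall x, f x = 0.
Proof.
move=> fP f0 x; apply/eqP/negP => /negP /(polyfun_nz fP)[z /f0 ->].
by rewrite eqxx.
Qed.

(** The bound [D], uniform in [x], lets [polyfun_order] write the tail of the expansion as a finite
    sum, hence as a polynomial function. *)
Lemma polyfun_horner (I : Type) (P : (option I -> F) -> F) : polyfun P ->
  exists (D : nat) (q : (I -> F) -> {poly F}),
    [/\ forall k, polyfun (fun x => (q x)`_k), forall x, (size (q x) <= D)%N
      & forall t x, P (ocons t x) = (q x).[t]].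
Proof.
elim=> [c|[i|]|f g _ [D [p [pP sp fE]]] _ [E [q [qP sq gE]]]
              |f g _ [D [p [pP sp fE]]] _ [E [q [qP sq gE]]]].
- exists 1%N, (fun=> c%:P); split=> [k|x|t x].
  + exact: polyfun_cst.
  + exact: size_polyC_leq1.
  + by rewrite hornerC.
- exists 1%N, (fun x => (x i)%:P); split=> [k|x|t x].
  + case: k => [|k].
      by apply: polyfun_ext (polyfun_var i) => x; rewrite coefC.
    by apply: polyfun_ext (polyfun_cst _ 0) => x; rewrite coefC.
  + exact: size_polyC_leq1.
  + by rewrite hornerC.
- exists 2%N, (fun=> 'X); split=> [k|x|t x].
  + exact: polyfun_cst.
  + by rewrite size_polyX.
  + by rewrite hornerX.
- exists (maxn D E), (fun x => p x + q x); split=> [k|x|t x].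
  + by apply: polyfun_ext (polyfun_add (pP k) (qP k)) => x; rewrite coefD.
  + by apply: leq_trans (size_polyD _ _) _; rewrite geq_max !leq_max sp sq orbT.
  + by rewrite hornerD fE gE.
- exists (D + E)%N, (fun x => p x * q x); split=> [k|x|t x].
  + have := polyfun_sum (index_enum 'I_k.+1) xpredT
      (fun j => polyfun_mul (pP (nat_of_ord j)) (qP (k - j)%N)).
    by apply: polyfun_ext => x; rewrite coefM.
  + apply: leq_trans (size_polyMleq _ _) _.
    by apply: leq_trans (leq_pred _) _; rewrite leq_add.
  + by rewrite hornerM fE gE.
Qed.

Lemma polyfun_upoly (I : Type) (P : (option I -> F) -> F) x :
  polyfun P -> upoly (fun t => P (ocons t x)).
Proof. by move=> /polyfun_horner[_ [q [_ _ PE]]]; exists (q x) => t. Qed.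

(** Factor out the largest power of the distinguished variable: [k] is the least exponent whose
    coefficient is not identically zero, and [c] is that coefficient. *)
Lemma polyfun_order (I : Type) (P : (option I -> F) -> F) z0 :
  polyfun P -> P z0 != 0 ->
  exists (k : nat) (c : (I -> F) -> F) (R : (option I -> F) -> F),
    [/\ polyfun c, polyfun R, exists x, c x != 0
      & forall t x, P (ocons t x) = t ^+ k * (c x + t * R (ocons t x))].
Proof.
move=> PP Pz; have [D [q [qP sq PE]]] := polyfun_horner PP.
have exk : exists k, `[< exists x, (q x)`_k != 0 >].
  apply/not_existsP => q0; move: Pz; rewrite (oconsE z0) PE.
  suff -> : q (z0 \o Some) = 0 by rewrite horner0 eqxx.
  apply/polyP => k; rewrite coef0; apply/eqP/negP => /negP qk.
  by apply: (q0 k); apply/asboolP; exists (z0 \o Some).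
have [k /asboolP kP kmin] := ex_minnP exk.
exists k, (fun x => (q x)`_k),
  (fun z => \sum_(j < D) (q (z \o Some))`_(k.+1 + j) * z None ^+ j); split=> //.
- apply: polyfun_sum => j; apply: polyfun_mul.
    by apply: (polyfun_comp (qP _)) => a; apply: polyfun_var.
  exact/polyfun_exp/polyfun_var.
- move=> t x; rewrite PE.
  have qlow j : (j < k)%N -> (q x)`_j = 0.
    move=> jk; apply/eqP/negP => /negP qj.
    have /kmin : `[< exists x, (q x)`_j != 0 >] by apply/asboolP; exists x.
    by rewrite leqNgt jk.
  have sE : (size (q x) <= k.+1 + D)%N by apply: leq_trans (sq x) (leq_addl _ _).
  rewrite (horner_coef_wide _ sE) big_split_ord big_ord_recr /= big1 ?add0r; last first.
    by move=> j _; rewrite qlow ?mul0r.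
  rewrite mulrDr mulrC; congr (_ + _).
  rewrite mulrA -exprSr mulr_sumr; apply: eq_bigr => j _ /=.
  by rewrite exprD mulrCA.
Qed.

(** * Degrees in each variable and algebraic dependence *)

Definition upd (I : eqType) (x : I -> F) (i : I) (t : F) : I -> F :=
  fun j => if j == i then t else x j.

(** The degree is bounded in each variable separately and read off on lines parallel to the axes,
    since a polynomial function carries no chosen polynomial. *)
Definition degle (I : eqType) (e : nat) (f : (I -> F) -> F) :=
  forall x i, exists2 p : {poly F}, (size p <= e.+1)%N &
    forall t, f (upd x i t) = p.[t].

Lemma degle_ext (I : eqType) e (f g : (I -> F) -> F) :
  f =1 g -> degle e f -> degle e g.
Proof. by move=> /funext ->. Qed.

Lemma degle_cst (I : eqType) e c : degle e (fun _ : I -> F => c).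
Proof.
move=> x i; exists c%:P; last by move=> t; rewrite hornerC.
exact: leq_trans (size_polyC_leq1 _) _.
Qed.

Lemma degle_add (I : eqType) e (f g : (I -> F) -> F) :
  degle e f -> degle e g -> degle e (fun x => f x + g x).
Proof.
move=> fP gP x i; have [p sp fE] := fP x i; have [q sq gE] := gP x i.
exists (p + q); last by move=> t; rewrite hornerD fE gE.
by apply: leq_trans (size_polyD _ _) _; rewrite geq_max sp sq.
Qed.

Lemma degle_mul (I : eqType) d e (f g : (I -> F) -> F) :
  degle d f -> degle e g -> degle (d + e) (fun x => f x * g x).
Proof.
move=> fP gP x i; have [p sp fE] := fP x i; have [q sq gE] := gP x i.
exists (p * q); last by move=> t; rewrite hornerM fE gE.
apply: leq_trans (size_polyMleq _ _) _; rewrite -subn1 leq_subLR.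
by rewrite add1n -addSn -addnS leq_add.
Qed.

Lemma degle_le (I : eqType) d e (f : (I -> F) -> F) :
  (d <= e)%N -> degle d f -> degle e f.
Proof.
move=> de fP x i; have [p sp fE] := fP x i; exists p => //.
exact: leq_trans sp _.
Qed.

Lemma degle_sum (I : eqType) (K : Type) (s : seq K) e (f : K -> (I -> F) -> F) :
  (forall k, degle e (f k)) -> degle e (fun x => \sum_(k <- s) f k x).
Proof.
move=> fP; elim: s => [|k s IH].
  by apply: degle_ext (@degle_cst I e 0) => x; rewrite big_nil.
by apply: degle_ext (degle_add (fP k) IH) => x; rewrite big_cons.
Qed.

Lemma degle_prod (I : eqType) (K : Type) (s : seq K) e (f : K -> (I -> F) -> F) :
  (forall k, degle e (f k)) -> degle (size s * e) (fun x => \prod_(k <- s) f k x).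
Proof.
move=> fP; elim: s => [|k s IH].
  by apply: degle_ext (@degle_cst I 0 1) => x; rewrite big_nil.
by apply: degle_ext (degle_mul (fP k) IH) => x; rewrite big_cons.
Qed.

Lemma polyfun_degle (I : eqType) (f : (I -> F) -> F) :
  polyfun f -> exists e, degle e f.
Proof.
elim=> [c|j|{}f g _ [d fP] _ [e gP]|{}f g _ [d fP] _ [e gP]].
- exists 0%N; exact: degle_cst.
- exists 1%N => x i; rewrite /upd; case: (j == i).
    by exists 'X => [|t]; rewrite ?size_polyX // hornerX.
  exists (x j)%:P => [|t]; last by rewrite hornerC.
  exact: leq_trans (size_polyC_leq1 _) _.
- by exists (d + e)%N; apply: degle_add; [apply: degle_le fP|apply: degle_le gP];
    rewrite ?leq_addr ?leq_addl.
- exists (d + e)%N; exact: degle_mul.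
Qed.

Lemma infinite_field d : exists h : 'I_d -> F, injective h.
Proof.
suff [s us sd] : exists2 s : seq F, uniq s & size s = d.
  exists (fun i => s`_i) => i j /eqP.
  by rewrite nth_uniq ?sd // => /eqP /val_inj.
elim: d => [|d [s us sd]]; first by exists [::].
have /closed_nonrootP[x xP] : \prod_(a <- s) ('X - a%:P) != 0 :> {poly F}.
  exact/monic_neq0/monic_prod_XsubC.
by exists (x :: s); rewrite /= ?sd // us -root_prod_XsubC xP.
Qed.

(** Induction on the number of coordinates off the grid: moving one of them through the [e.+1] grid
    values gives more roots than a nonzero polynomial of degree at most [e] can have. *)
Lemma degle_grid_eq0 (I : finType) e (f : (I -> F) -> F) (h : 'I_e.+1 -> F) :
  injective h -> degle e f -> (forall g : {ffun I -> 'I_e.+1}, f (h \o g) = 0) ->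
  forall x, f x = 0.
Proof.
move=> hI fP f0 x; pose bad y := [set i : I | y i \notin codom h]%SET.
move: {2}#|bad x| (leqnn #|bad x|) => m; elim: m x => [|m IH] x.
  rewrite leqn0 cards_eq0 => /eqP bad0.
  have cod i : x i \in codom h.
    by have := finset.in_set0 i; rewrite -bad0 inE => /negbFE.
  suff -> : x = h \o [ffun i => iinv (cod i)] by apply: f0.
  by apply/funext => i /=; rewrite ffunE f_iinv.
have [b0|/finset.set0Pn[i ibad] cbad] := eqVneq (bad x) finset.set0.
  by move=> _; apply: IH; rewrite b0 cards0.
have [p sp pE] := fP x i.
suff p0 : p = 0.
  have -> : x = upd x i (x i) by apply/funext => j; rewrite /upd; case: eqP => // ->.
  by rewrite pE p0 horner0.
apply/eqP/negP => /negP p0.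
have : (size (codom h) < size p)%N.
  apply: max_poly_roots => //; last by rewrite map_inj_uniq ?enum_uniq.
  apply/allP => y /codomP[b ->]; apply/rootP; rewrite -pE; apply: IH.
  rewrite -ltnS; apply: leq_trans cbad; apply: proper_card.
  apply/properP; split; last first.
    by exists i => //; rewrite inE /upd eqxx negbK codom_f.
  apply/fintype.subsetP => j; rewrite !inE /upd; case: eqP => // ->.
  by rewrite codom_f.
by rewrite size_codom card_ord ltnNge sp.
Qed.

(* A linear combination of Lagrange polynomials on a grid of size [d ^ #|I'|]
   is nonzero as soon as one coefficient is; its composite with [u] has degree
   linear in [d] in each variable, so vanishing is fewer than [d ^ #|I'|]
   linear conditions on the coefficients. *)
Lemma polyfun_dependent (I I' : finType) (u : (I -> F) -> I' -> F) :
  (#|I| < #|I'|)%N -> (forall a, polyfun (fun x => u x a)) ->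
  exists P, [/\ polyfun P, exists y, P y != 0 & forall x, P (u x) = 0].
Proof.
move=> card_lt uP.
have [D uD] : exists D, forall a, degle D (fun x => u x a).
  have /choice[d dP] a := polyfun_degle (uP a).
  by exists (\max_a d a) => a; apply: degle_le (dP a); apply: leq_bigmax.
(* With N = [#|I'|], the composites have degree at most e = N d D in each variable and e + 1 <= (N D
   + 1) d. The choice of [d] makes (N D + 1)^#|I| < d, so the test grid has fewer than d^(#|I| + 1)
   <= d^#|I'| points. *)
pose d := ((#|I'| * D).+1 ^ #|I|).+1; pose e := (#|I'| * (d * D))%N.
have [h hI] := infinite_field d; have [g gI] := infinite_field e.+1.
pose lag (m : {ffun I' -> 'I_d}) (y : I' -> F) := \prod_(a : I') \prod_(b : 'I_d)
  if b == m a then 1 else (y a - h b) / (h (m a) - h b).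
have lagP m : polyfun (lag m).
  apply: polyfun_prod => a; apply: polyfun_prod => b; case: eqP => _.
    exact: polyfun_cst.
  apply: polyfun_mul; last exact: polyfun_cst.
  by apply: polyfun_sub; [apply: polyfun_var|apply: polyfun_cst].
have lagE (m m' : {ffun I' -> 'I_d}) : lag m (h \o m') = (m == m')%:R.
  have [<-|/eqP mm'] := eqVneq.
    apply: big1 => a _; apply: big1 => b _; case: eqP => [//|bm].
    by rewrite divff // subr_eq0 (inj_eq hI) eq_sym; apply/eqP.
  have [a ma] : exists a, m a != m' a.
    apply/not_existsP => H; apply: mm'; apply/ffunP => a.
    by apply/eqP/negP => /negP /H.
  by rewrite /lag (bigD1 a) //= (bigD1 (m' a)) //= eq_sym (negbTE ma) subrr !mul0r.
have lagD m : degle e (fun x => lag m (u x)).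
  rewrite /e cardT enumT; apply: degle_prod => a.
  rewrite -[d in (d * D)%N]size_enum_ord enumT; apply: degle_prod => b.
  case: eqP => _; first exact: degle_cst.
  rewrite -[D]addn0; apply: degle_mul; last exact: degle_cst.
  by apply: degle_add => //; apply: degle_cst.
pose M := \matrix_(i < #|{ffun I' -> 'I_d}|, j < #|{ffun I -> 'I_e.+1}|)
  lag (enum_val i) (u (g \o (enum_val j : {ffun I -> 'I_e.+1}))).
have cMlt : (#|{ffun I -> 'I_e.+1}| < #|{ffun I' -> 'I_d}|)%N.
  rewrite !card_ffun !card_ord.
  apply: (@leq_ltn_trans (((#|I'| * D).+1 * d) ^ #|I|)).
    by case: (#|I|) => // k; rewrite leq_exp2r // mulSn /e mulnCA [(d * _)%N]mulnC addnC
       -add1n addnC leq_add2l.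
  rewrite expnMn; apply: (@leq_trans (d ^ #|I|.+1)); last by rewrite leq_pexp2l.
  by rewrite expnS ltn_pmul2r ?expn_gt0.
have /rowV0Pn[v /sub_kermxP vM v0] : kermx M != 0.
  rewrite kermx_eq0 /row_free neq_ltn; apply/orP; left.
  exact: leq_ltn_trans (rank_leq_col _) cMlt.
exists (fun y => \sum_i v 0 i * lag (enum_val i) y); split.
- by apply: polyfun_sum => i; apply: polyfun_mul => //; apply: polyfun_cst.
- have [i vi] : exists i, v 0 i != 0.
    apply/not_existsP => H; case/eqP: v0; apply/rowP => i; rewrite mxE.
    by apply/eqP/negP => /negP /H.
  exists (h \o (enum_val i : {ffun I' -> 'I_d})); rewrite (bigD1 i) //= lagE eqxx mulr1.
  rewrite big1 ?addr0 // => j ji; rewrite lagE.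
  by rewrite (inj_eq enum_val_inj) (negbTE ji) mulr0.
- apply: (degle_grid_eq0 gI); first apply: degle_sum => i.
    by rewrite -[e]add0n; apply: degle_mul => //; apply: degle_cst.
  move=> m; have /rowP/(_ (enum_rank m)) := vM; rewrite !mxE => vE.
  by rewrite -[RHS]vE; apply: eq_bigr => i _; rewrite mxE enum_rankK.
Qed.

End PolynomialFunctions.

(** * Families of matrices and their tangent vectors *)

Lemma sum_option (V : nmodType) (J : finType) (f : option J -> V) :
  \sum_o f o = f None + \sum_j f (Some j).
Proof.
rewrite (bigD1 None) //= (reindex_omap Some id) /=; last by case.
by congr (_ + _); apply: eq_bigl => j; rewrite eqxx.
Qed.

Lemma polyfun_det (F : closedFieldType) (J : Type) k (f : (J -> F) -> 'M[F]_k) :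
  (forall i j, polyfun (fun x => f x i j)) -> polyfun (fun x => \det (f x)).
Proof.
move=> fP; apply: polyfun_sum => s; apply: polyfun_mul; first exact: polyfun_cst.
by apply: polyfun_prod => i; apply: fP.
Qed.

Section Tangent.
Variables (F : closedFieldType) (n : nat).
Implicit Types (A B : 'M[F]_n).

Definition polymx (J : Type) (h : (J -> F) -> 'M[F]_n) :=
  forall k l, polyfun (fun x => h x k l).

(* [E j] is the partial derivative of [g] at the point [(1, .., 1)], where
   [g] takes the value [1]. *)
Definition tangent (J : finType) (g : (J -> F) -> 'M[F]_n) (E : J -> 'M[F]_n) :=
  forall v : J -> F, exists2 r : F -> 'M[F]_n,
    forall k l, upoly (fun t => r t k l) &
    forall t, g (fun j => 1 + t * v j) = 1%:M + t *: (\sum_j v j *: E j) + t ^+ 2 *: r t.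

Definition lin_indep (J : finType) (E : J -> 'M[F]_n) :=
  forall c : J -> F, \sum_j c j *: E j = 0 -> forall j, c j = 0.

Lemma polymx_adj (J : Type) (f : (J -> F) -> 'M[F]_n) :
  polymx f -> polymx (fun x => \adj (f x)).
Proof.
move=> fP i j; apply: (@polyfun_ext _ _ (fun x => (-1) ^+ (j + i) *
    \det (row' j (col' i (f x))))); first by move=> x; rewrite mxE.
apply: polyfun_mul; first exact: polyfun_cst.
apply: polyfun_det => k l; apply: polyfun_ext (fP (lift j k) (lift i l)) => x.
by rewrite !mxE.
Qed.

Lemma upoly_cst (c : F) : upoly (fun=> c).
Proof. by exists c%:P => t; rewrite hornerC. Qed.

Lemma upoly_id : @upoly F id.
Proof. by exists 'X => t; rewrite hornerX. Qed.

Lemma upoly_add (f g : F -> F) : upoly f -> upoly g -> upoly (fun t => f t + g t).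
Proof. by move=> [p fE] [q gE]; exists (p + q) => t; rewrite hornerD fE gE. Qed.

Lemma upoly_mul (f g : F -> F) : upoly f -> upoly g -> upoly (fun t => f t * g t).
Proof. by move=> [p fE] [q gE]; exists (p * q) => t; rewrite hornerM fE gE. Qed.

Lemma upoly_ext (f g : F -> F) : f =1 g -> upoly f -> upoly g.
Proof. by move=> /funext ->. Qed.

Lemma upoly_sum (I : Type) (s : seq I) (f : I -> F -> F) :
  (forall i, upoly (f i)) -> upoly (fun t => \sum_(i <- s) f i t).
Proof.
move=> fP; elim: s => [|i s IH].
  by apply: upoly_ext (upoly_cst 0) => x; rewrite big_nil.
by apply: upoly_ext (upoly_add (fP i) IH) => x; rewrite big_cons.
Qed.

Lemma upoly_mulmx (m p q : nat) (f : F -> 'M[F]_(m, p)) (g : F -> 'M[F]_(p, q)) :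
  (forall k l, upoly (fun t => f t k l)) -> (forall k l, upoly (fun t => g t k l)) ->
  forall k l, upoly (fun t => (f t *m g t) k l).
Proof.
move=> fP gP k l.
have := upoly_sum (index_enum 'I_p) (fun j => upoly_mul (fP k j) (gP j l)).
by apply: upoly_ext => t; rewrite mxE.
Qed.

(** The trace form is nondegenerate: a right inverse of the matrix of vectorised [E] provides the
    dual forms. On a family with derivatives [E] they act as coordinates to first order. *)
Lemma dual_family (J : finType) (E : J -> 'M[F]_n) : lin_indep E ->
  exists L : J -> 'M[F]_n, forall a b, \tr (L a *m E b) = (a == b)%:R.
Proof.
move=> Ei; pose R := \matrix_(i < #|J|) mxvec (E (enum_val i)).
have /row_freeP[B RB] : row_free R.
  rewrite -kermx_eq0; apply/rowV0P => v /sub_kermxP vR.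
  have /Ei v0 : \sum_j v 0 (enum_rank j) *: E j = 0.
    apply: (can_inj mxvecK); rewrite linear0 -[RHS]vR mulmx_sum_row linear_sum.
    rewrite (reindex_onto enum_val enum_rank) /=; last by move=> *; apply: enum_rankK.
    apply: eq_big => [i|i _]; first by rewrite enum_valK eqxx.
    by rewrite linearZ /= enum_valK rowK.
  by apply/rowP => i; rewrite -[i]enum_valK v0 mxE.
(* The indices are swapped because the trace of [L *m E] pairs the entry (k, l) of [L] with the
   entry (l, k) of [E]. *)
exists (fun a => \matrix_(k, l) B (mxvec_index l k) (enum_rank a)) => a b.
have /matrixP/(_ (enum_rank b) (enum_rank a)) := RB.
rewrite [in RHS]mxE (inj_eq enum_rank_inj) eq_sym => <-; rewrite mxE /mxtrace.
rewrite (reindex _ (curry_mxvec_bij _ _)) /=.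
rewrite [RHS](eq_bigr (fun p => R (enum_rank b) (mxvec_index p.1 p.2) *
  B (mxvec_index p.1 p.2) (enum_rank a))); last by case.
rewrite -(pair_bigA _ (fun k l => R (enum_rank b) (mxvec_index k l) *
  B (mxvec_index k l) (enum_rank a))) exchange_big /=; apply: eq_bigr => k _; rewrite mxE; apply: eq_bigr => l _.
by rewrite !mxE enum_rankK mxvecE mulrC.
Qed.

Lemma polyfun_trace (J : Type) (h : (J -> F) -> 'M[F]_n) (L : 'M[F]_n) :
  polymx h -> polyfun (fun x => \tr (L *m h x)).
Proof.
move=> hP; apply: polyfun_sum => k.
have := polyfun_sum (index_enum 'I_n) xpredT
  (fun l => polyfun_mul (polyfun_cst _ (L k l)) (hP l k)).
by apply: polyfun_ext => x; rewrite mxE.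
Qed.

(* The term of lowest order of [P] at [L (g 1)] survives along a line through
   [(1, .., 1)], since the derivative of [L (g x)] there is the identity. *)
Lemma polyfun_tangent_nz (J : finType) (g : (J -> F) -> 'M[F]_n)
    (E L : J -> 'M[F]_n) (P : (J -> F) -> F) y0 :
  polymx g -> tangent g E -> (forall a b, \tr (L a *m E b) = (a == b)%:R) ->
  polyfun P -> P y0 != 0 ->
  exists2 x, nonvanishing x & P (fun a => \tr (L a *m g x)) != 0.
Proof.
move=> gP gE LE PP Py.
suff [x] : exists x, P (fun a => \tr (L a *m g x)) != 0.
  by apply: (polyfun_nz (polyfun_comp PP _)) => a; apply: polyfun_trace.
apply/not_existsP => P0; pose c a := \tr (L a).
pose Q (z : option J -> F) := P (fun a => c a + z None * z (Some a)).
have QP : polyfun Q.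
  apply: (polyfun_comp PP) => a; apply: polyfun_add; first exact: polyfun_cst.
  by apply: polyfun_mul; apply: polyfun_var.
have Q1 : Q (ocons 1 (fun a => y0 a - c a)) != 0.
  rewrite /Q /=; suff -> : (fun a => c a + 1 * (y0 a - c a)) = y0 by [].
  by apply/funext => a; rewrite mul1r addrC subrK.
have [k [p [R [pP RP [v pv] QE]]]] := polyfun_order QP Q1.
(* Along the line with direction [v] the forms take exactly the values [c + t * w t], with
   [w 0 = v]. So [P] there is [t ^+ k] times a polynomial in [t] whose value at 0 is [p v], which is
   nonzero. *)
have [r rP gvE] := gE v; pose w t a := v a + t * \tr (L a *m r t).
have wE t : P (fun a => \tr (L a *m g (fun j => 1 + t * v j))) = Q (ocons t (w t)).
  congr P; apply/funext => a /=; rewrite gvE !mulmxDr !mxtraceD mulmx1.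
  rewrite -!scalemxAr !mxtraceZ mulmx_sumr linear_sum /= (bigD1 a) //=.
  rewrite -scalemxAr mxtraceZ LE eqxx mulr1 big1 ?addr0; last first.
    by move=> b ba; rewrite -scalemxAr mxtraceZ LE eq_sym (negbTE ba) mulr0.
  by rewrite /w mulrDr -addrA expr2 mulrA.
have wP a : upoly (w^~ a).
  apply: upoly_add (upoly_cst _) (upoly_mul upoly_id _).
  apply: upoly_sum => i; apply: upoly_mulmx => // ? ?; exact: upoly_cst.
have fP : upoly (fun t => p (w t) + t * R (ocons t (w t))).
  apply: upoly_add; first exact: polyfun_curve wP.
  apply: (upoly_mul upoly_id); apply: (polyfun_curve (u := fun t => ocons t (w t)) RP).
  by case=> [a|]; [exact: wP|exact: upoly_id].
have w0 : w 0 = v by apply/funext => a; rewrite /w mul0r addr0.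
suff /(_ 0) : forall t, p (w t) + t * R (ocons t (w t)) = 0.
  by rewrite mul0r addr0 w0; apply/eqP.
apply: (upoly_eq0 fP) => t t0; have := P0 (fun j => 1 + t * v j).
rewrite wE QE => /negP; rewrite negbK mulf_eq0 expf_eq0 (negbTE t0) andbF /=.
by move/eqP.
Qed.

(** With [None] as a nonzero scaling factor, this parametrises all lifts of the classes in the
    image. *)
Definition cone (J : Type) (f : (J -> F) -> 'M[F]_n) (z : option J -> F) :=
  z None *: f (z \o Some).

Lemma polymx_cone (J : Type) (f : (J -> F) -> 'M[F]_n) : polymx f -> polymx (cone f).
Proof.
move=> fP k l; have fS : polyfun (fun z : option J -> F => f (z \o Some) k l).
  by apply: (polyfun_comp (fP k l)) => a; apply: polyfun_var.
by apply: polyfun_ext (polyfun_mul (polyfun_var _ None) fS) => z; rewrite mxE.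
Qed.

(** As [f] takes the value 1 at the base point, the derivative in the scaling direction is the
    identity matrix. *)
Lemma tangent_cone (J : finType) (f : (J -> F) -> 'M[F]_n) (E : J -> 'M[F]_n) :
  tangent f E -> tangent (cone f) (fun o => oapp E 1%:M o).
Proof.
move=> fE v; have [r rP fvE] := fE (v \o Some).
pose S := \sum_j (v \o Some) j *: E j.
exists (fun t => v None *: S + (1 + t * v None) *: r t) => [k l|t].
  apply: (@upoly_ext (fun t => (v None *: S) k l + (1 + t * v None) * r t k l)).
    by move=> t; rewrite !mxE.
  apply: upoly_add (upoly_cst _) (upoly_mul _ (rP k l)); exact: upoly_affine.
rewrite /cone.
have -> : (fun j => 1 + t * v j) \o Some = (fun j => 1 + t * (v \o Some) j) by [].
rewrite fvE sum_option -/S /=; move: S (r t) => S R; apply/matrixP => k l; rewrite !mxE.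
by ring.
Qed.

Lemma tangent_mul (J : finType) (f g : (J -> F) -> 'M[F]_n) (D E : J -> 'M[F]_n) :
  tangent f D -> tangent g E ->
  tangent (fun x => f x *m g x) (fun j => D j + E j).
Proof.
move=> fD gE v; have [r rP fvE] := fD v; have [q qP gvE] := gE v.
pose S := \sum_j v j *: D j; pose T := \sum_j v j *: E j.
exists (fun t => S *m T + r t + q t + t *: (S *m q t + r t *m T) + t ^+ 2 *: (r t *m q t)).
  move=> k l; apply: (@upoly_ext (fun t => (S *m T) k l + r t k l + q t k l +
      t * ((S *m q t) k l + (r t *m T) k l) + t * t * (r t *m q t) k l)).
    by move=> t; rewrite !mxE expr2.
  have cP (A : 'M[F]_n) k' l' : upoly (fun _ => A k' l') by exact: upoly_cst.
  apply: upoly_add (upoly_mul (upoly_mul upoly_id upoly_id) (upoly_mulmx _ _ _ _)) => //.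
  apply: upoly_add (upoly_mul upoly_id (upoly_add (upoly_mulmx _ _ _ _) (upoly_mulmx _ _ _ _))) => //.
  by apply: upoly_add => //; apply: upoly_add.
move=> t; rewrite fvE gvE; under [in RHS]eq_bigr do rewrite scalerDr.
rewrite big_split /= -/S -/T; move: S T (r t) (q t) => S T R Q.
rewrite !(mulmxDl, mulmxDr) !mul1mx !mulmx1 -!scalemxAl -!scalemxAr.
move: (S *m T) (R *m Q) (S *m Q) (R *m T) => ST RQ SQ RT.
by apply/matrixP => k l; rewrite !mxE; ring.
Qed.

Lemma tangent_prod (J : finType) (I : Type) (s : seq I)
    (f : I -> (J -> F) -> 'M[F]_n) (E : I -> J -> 'M[F]_n) :
  (forall i, tangent (f i) (E i)) ->
  tangent (fun x => \big[mulmx/1%:M]_(i <- s) f i x) (fun j => \sum_(i <- s) E i j).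
Proof.
move=> fE; elim: s => [|i s IH].
  move=> v; exists (fun=> 0) => [k l|t]; first by rewrite mxE; apply: upoly_cst.
  rewrite big_nil scaler0 addr0 big1 ?scaler0 ?addr0 // => j _.
  by rewrite big_nil scaler0.
move=> v; have [r rP fvE] := tangent_mul (fE i) IH v; exists r => // t.
by rewrite big_cons fvE; under [in RHS]eq_bigr do rewrite big_cons.
Qed.

End Tangent.

(** * Closed subsets of PGL *)

Section Peval.
Variable F : closedFieldType.

Lemma polyfun_peval (J : finType) (p : mpoly #|J| F) : polyfun (@peval F J p).
Proof.
apply: (@polyfun_ext _ _ (fun x : J -> F => \sum_(m <- msupp p) mcoeff m p *
    \prod_i x (enum_val i) ^+ m i)); first by move=> x; rewrite /peval mevalE.
apply: polyfun_sum => m; apply: polyfun_mul; first exact: polyfun_cst.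
by apply: polyfun_prod => i; apply/polyfun_exp/polyfun_var.
Qed.

Lemma peval_polyfun (J : finType) (f : (J -> F) -> F) : polyfun f ->
  exists p : mpoly #|J| F, forall x, f x = peval p x.
Proof.
elim=> [c|i|{}f g _ [p fE] _ [q gE]|{}f g _ [p fE] _ [q gE]].
- by exists (mpolyC #|J| c) => x; rewrite /peval mevalC.
- by exists (mpolyX F (mnm1 (enum_rank i))) => x; rewrite /peval mevalXU enum_rankK.
- by exists (p + q) => x; rewrite /peval mevalD fE gE.
- by exists (p * q) => x; rewrite pevalM fE gE.
Qed.

Lemma zariski_openP (J : finType) (U : set (affine F J)) :
  open U <-> exists S : set (affine F J -> F), (forall f, S f -> polyfun f) /\
    U = [set x | exists2 f, S f & f x != 0].
Proof.
split=> [[S ->]|[S [SP ->]]].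
  exists [set f | exists2 p, S p & f = peval p]; split.
    by move=> _ [p _ ->]; apply: polyfun_peval.
  rewrite eqEsubset; split=> x [p Sp px]; first by exists (peval p) => //; exists p.
  by case: Sp => q Sq pE; exists q; rewrite // -pE.
exists [set p | exists2 f, S f & f = peval p].
rewrite eqEsubset; split=> x [f Sf fx].
  have [p pE] := peval_polyfun (SP _ Sf); exists p; last by rewrite -pE.
  by exists f => //; apply/funext.
by case: Sf => g Sg gE; exists g; rewrite // gE.
Qed.

End Peval.

Section ProjectiveClosedSets.
Variables (F : closedFieldType) (n : nat).
Local Notation G := (PGL F n).
Local Notation M := ('M[F]_n).
Local Notation coord := ('I_n * 'I_n)%type.

Definition entries (A : M) : coord -> F := fun ij => A ij.1 ij.2.

(* Polynomials on matrices do not descend to [PGL]; [vanish p] is the largest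
   set of classes on whose lifts [p] vanishes. *)
Definition vanish (p : (coord -> F) -> F) : set G :=
  [set z | forall A : GL F n, toPGL A = z -> p (entries A) = 0].

(** Singular matrices go to the default value 1. *)
Definition toGL (A : M) : GL F n := insubd (1%g : GL F n) A.

Lemma toGLK (A : M) : A \in unitmx -> GLmx (toGL A) = A.
Proof. by move=> uA; apply: (insubdK (1%g : GL F n)). Qed.

Lemma GLmxK (A : GL F n) : toGL A = A.
Proof. exact: valKd. Qed.

Lemma toPGL_lift (A B : GL F n) :
  toPGL A = toPGL B -> exists2 c : F, c != 0 & GLmx A = c *: GLmx B.
Proof. by move/toPGL_eqP. Qed.

Lemma open_GL (U : set (GL F n)) :
  open U <-> exists2 V, open V & U = @GLentries F n @^-1` V.
Proof. by split=> -[V oV VE]; exists V. Qed.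

Lemma open_PGL (U : set G) : open U <-> open (@toPGL F n @^-1` U).
Proof. by []. Qed.

(** A class lies outside [vanish p] when some nonzero multiple of a lift is not a zero of [p], so
    all the functions [p (c x)] with c nonzero together define the preimage. *)
Lemma open_nonvanish (p : (coord -> F) -> F) : polyfun p -> open (~` vanish p).
Proof.
move=> pP; apply/open_PGL/open_GL.
exists [set x : affine F coord | exists2 f, [set f | exists2 c, c != 0 &
    f = fun x : coord -> F => p (fun ij => c * x ij)] f & f x != 0].
  apply/zariski_openP; exists [set f | exists2 c, c != 0 &
    f = fun x : coord -> F => p (fun ij => c * x ij)]; split=> // _ [c c0 ->].
  apply: (polyfun_comp pP) => ij; apply: polyfun_mul; first exact: polyfun_cst.
  exact: polyfun_var.
rewrite eqEsubset; split=> A /=.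
  move/existsNP => [B /not_implyP[/toPGL_lift[c c0 BE] /eqP pB]].
  exists (fun x : coord -> F => p (fun ij => c * x ij)); first by exists c.
  suff -> : (fun ij => c * GLentries A ij) = entries B by [].
  by apply/funext => ij; rewrite /entries BE mxE.
move=> [_ [c c0 ->] pA].
have uA : c *: GLmx A \in unitmx by rewrite unitmxZ ?GLunit ?unitfE.
move=> /(_ (MkGL uA)) pE; case/eqP: pA; rewrite -[RHS]pE; last first.
  by apply/toPGL_eqP; exists c.
by congr p; apply/funext => ij; rewrite /entries mxE.
Qed.

Lemma closed_vanish (p : (coord -> F) -> F) : polyfun p -> closed (vanish p).
Proof. by move=> pP; rewrite -[vanish p]setCK; apply/open_closedC/open_nonvanish. Qed.

Lemma closure_vanish (p : (coord -> F) -> F) (X : set G) :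
  polyfun p -> X `<=` vanish p -> closure X `<=` vanish p.
Proof. by move=> pP XV; rewrite closureE; apply: smallest_sub => //; apply: closed_vanish. Qed.

(** The preimage in GL of the complement of [Z] is a union of principal open sets; one containing
    [A] gives [p], which vanishes at every lift of a point of [Z] because such lifts lie outside the
    preimage. *)
Lemma closed_separate (Z : set G) (A : GL F n) : closed Z -> ~ Z (toPGL A) ->
  exists p, [/\ polyfun p, Z `<=` vanish p & p (entries A) != 0].
Proof.
move=> /closed_openC/open_PGL/open_GL[V /zariski_openP[S [SP VE]] ZV] ZA.
have : (@GLentries F n @^-1` V) A by rewrite -ZV.
rewrite /preimage /= VE => -[p Sp pA]; exists p; split=> //; first exact: SP.
move=> z Zz B Bz; apply/eqP/negP => /negP pB.
have : (@GLentries F n @^-1` V) B by rewrite /preimage /= VE; exists p.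
by rewrite -ZV; apply; rewrite Bz.
Qed.

(** A priori [p] and [q] are nonzero at different lifts of one class. These lifts lie on a common
    line through 0, and at a generic point of that line, again a lift, both are nonzero. *)
Lemma irreducible_vanish (Z : set G) (p q : (coord -> F) -> F) :
  irreducible_set Z -> polyfun p -> polyfun q ->
  Z `<=` vanish (fun x => p x * q x) -> Z `<=` vanish p \/ Z `<=` vanish q.
Proof.
move=> [_ Zirr] pP qP Zpq; apply: Zirr; [exact: closed_vanish..|].
move=> z Zz; apply: contrapT => /not_orP[/existsNP[A /not_implyP[Az /eqP pA]]].
move=> /existsNP[B /not_implyP[Bz /eqP qB]].
have [c c0 BE] : exists2 c : F, c != 0 & GLmx B = c *: GLmx A.
  by apply: toPGL_lift; rewrite Az.
pose u t : coord -> F := entries (t *: GLmx A).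
have uP a : upoly (u^~ a).
  exists ('X * (entries A a)%:P) => t.
  by rewrite hornerM hornerX hornerC /u /entries mxE.
have p1 : p (u 1) != 0 by rewrite /u scale1r.
(* The factor [c] keeps the common point away from the zero matrix. *)
have qc : c * q (u c) != 0 by rewrite mulf_neq0 // /u -BE.
have [t [pt]] := upoly_nz2 (polyfun_curve pP uP)
  (upoly_mul (upoly_id F) (polyfun_curve qP uP)) p1 qc.
rewrite mulf_eq0 negb_or => /andP[t0 qt].
have utA : t *: GLmx A \in unitmx by rewrite unitmxZ ?GLunit ?unitfE.
have tz : toPGL (MkGL utA) = z by rewrite -Az; apply/toPGL_eqP; exists t.
by have /eqP := Zpq _ Zz _ tz; rewrite mulf_eq0 (negbTE pt) (negbTE qt).
Qed.

Section Family.
Variables (J : finType) (f : (J -> F) -> M).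

Definition family_unit := forall x, nonvanishing x -> f x \in unitmx.

Definition image_PGL : set G := [set toPGL (toGL (f x)) | x in @nonvanishing F J].

Hypotheses (fP : polymx f) (fU : family_unit).

Lemma cone_unit z : nonvanishing z -> cone f z \in unitmx.
Proof.
move=> z0; rewrite /cone unitmxZ ?unitfE //; apply: fU => j; exact: z0.
Qed.

Lemma toPGL_cone z : nonvanishing z ->
  toPGL (toGL (cone f z)) = toPGL (toGL (f (z \o Some))).
Proof.
move=> z0; apply/toPGL_eqP; exists (z None) => //.
rewrite !toGLK //; first by apply: fU => j; apply: z0.
exact: cone_unit.
Qed.

Lemma cone_lift (A : GL F n) x : nonvanishing x -> toPGL A = toPGL (toGL (f x)) ->
  exists2 c : F, c != 0 & GLmx A = cone f (ocons c x).
Proof. by move=> x0 /toPGL_lift[c c0 AE]; exists c; rewrite // AE toGLK ?fU. Qed.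

Lemma image_vanish (p : (coord -> F) -> F) :
  image_PGL `<=` vanish p <->
  forall z, nonvanishing z -> p (entries (cone f z)) = 0.
Proof.
split=> [fp z z0|H _ [x x0 <-] A /(cone_lift x0)[c c0 ->]]; last first.
  by apply: H => -[].
rewrite -(toGLK (cone_unit z0)).
apply: (fp (toPGL (toGL (f (z \o Some))))); last exact: toPGL_cone.
by exists (z \o Some) => // j; apply: z0.
Qed.

Lemma polyfun_entries_cone (p : (coord -> F) -> F) :
  polyfun p -> polyfun (fun z => p (entries (cone f z))).
Proof. by move=> pP; apply: (polyfun_comp pP) => a; apply: polymx_cone. Qed.

Lemma image_irreducible : irreducible_set (closure image_PGL).
Proof.
split.
  exists (toPGL (toGL (f (fun=> 1)))); apply: subset_closure.
  by exists (fun=> 1) => // j; apply: oner_neq0.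
move=> C D cC cD CD.
have separate E : closed E -> ~ (closure image_PGL `<=` E) ->
    exists p z, [/\ polyfun p, E `<=` vanish p & p (entries (cone f z)) != 0].
  move=> cE nE; have /existsNP[y /not_implyP[[x x0 <-] Ex]] : ~ (image_PGL `<=` E).
    by move=> fE; apply: nE; rewrite closureE; apply: smallest_sub.
  have [p [pP Ep pA]] := closed_separate cE Ex.
  exists p, (ocons 1 x); split=> //; rewrite toGLK in pA; last exact: fU.
  by rewrite /cone /= scale1r.
apply: contrapT => /not_orP[/(separate _ cC)[p [y [pP Cp py]]] /(separate _ cD)[q [z [qP Dq qz]]]].
have [w [pw qw]] := polyfun_nz2 (polyfun_entries_cone pP) (polyfun_entries_cone qP) py qz.
have [{pw qw}w w0] := polyfun_nz (polyfun_mul (polyfun_entries_cone pP)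
  (polyfun_entries_cone qP)) (mulf_neq0 pw qw).
rewrite mulf_eq0 negb_or => /andP[pw qw].
have wE : GLmx (toGL (cone f w)) = cone f w by apply/toGLK/cone_unit.
have /CD[/Cp|/Dq] : closure image_PGL (toPGL (toGL (cone f w))).
- apply: subset_closure; exists (w \o Some); last by rewrite toPGL_cone.
  by move=> j; apply: w0.
- by move=> /(_ _ erefl)/eqP; rewrite wE (negbTE pw).
- by move=> /(_ _ erefl)/eqP; rewrite wE (negbTE qw).
Qed.

End Family.

End ProjectiveClosedSets.

(** * Dimension of the image of a family *)

Section Dimension.
Variables (F : closedFieldType) (n : nat).
Local Notation G := (PGL F n).
Local Notation M := ('M[F]_n).
Local Notation coord := ('I_n * 'I_n)%type.

Definition mx_of (x : coord -> F) : M := \matrix_(i, j) x (i, j).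

Lemma entriesK A : mx_of (entries A) = A.
Proof. by apply/matrixP => i j; rewrite mxE. Qed.

Lemma polymx_mx_of : polymx mx_of.
Proof. by move=> i j; apply: polyfun_ext (polyfun_var _ (i, j)) => x; rewrite mxE. Qed.

(** If [J] were larger, the [#|J|.+1] forms dual to [E] and 1 would satisfy a relation on the cone
    over [f'], which has [#|J'|.+1] parameters. The relation passes to the closure, hence to the
    cone over [f], against [polyfun_tangent_nz]. This makes the chain of coordinate subtori
    strict. *)
Lemma image_sub_card (J J' : finType) (f : (J -> F) -> M) (f' : (J' -> F) -> M)
    (E : J -> M) :
  polymx f -> family_unit f -> polymx f' -> family_unit f' ->
  tangent f E -> lin_indep (fun o => oapp E 1%:M o) ->
  image_PGL f `<=` closure (image_PGL f') -> (#|J| <= #|J'|)%N.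
Proof.
move=> fP fU f'P f'U fE Ei ff'; rewrite leqNgt; apply/negP => ltJ.
have [L LE] := dual_family Ei.
have [|a|P [PP [y0 Py] Pu]] := @polyfun_dependent _ (option J') (option J)
    (fun z a => \tr (L a *m cone f' z)).
- by rewrite !card_option ltnS.
- by apply: polyfun_trace; apply: polymx_cone.
pose p x := P (fun a => \tr (L a *m mx_of x)).
have pP : polyfun p.
  by apply: (polyfun_comp PP) => a; apply/polyfun_trace/polymx_mx_of.
have f'p : image_PGL f' `<=` vanish p.
  by apply/(image_vanish f'U) => z _; rewrite /p entriesK.
have /(image_vanish fU) fp := subset_trans ff' (closure_vanish pP f'p).
have [z z0] := polyfun_tangent_nz (polymx_cone fP) (tangent_cone fE) LE PP Py.
by have := fp z z0; rewrite /p entriesK => ->; rewrite eqxx.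
Qed.

Lemma closed_field_root k (c : F) : (0 < k)%N -> exists t, t ^+ k = c.
Proof.
move=> k0; have [t tE] := @solve_monicpoly F k (fun i => if i == 0%N then c else 0) k0.
exists t; rewrite tE; case: k k0 {tE} => // k _.
rewrite big_ord_recl /= expr0 mulr1 big1 ?addr0 // => i _.
by rewrite mul0r.
Qed.

(* The determinant separates scalars, and each step of the chain adds a
   polynomial vanishing on [Z i] but not on [Z i.+1]. *)
Lemma chain_independent (X : set G) d Z i : (0 < n)%N -> irreducible_chain X d Z ->
  (i <= d)%N -> exists (I : finType) (q : I -> (coord -> F) -> F),
  [/\ #|I| = i.+1, forall a, polyfun (q a) & forall P, polyfun P ->
    Z i `<=` vanish (fun x => P (fun a => q a x)) -> forall y, P y = 0].
Proof.
move=> n0 [Zirr Zlt]; elim: i => [|i IH] id.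
  exists unit, (fun _ x => \det (mx_of x)); split=> [|_|P PP ZP].
  - by rewrite card_unit.
  - exact/polyfun_det/polymx_mx_of.
  apply: (polyfun_eq0 PP) => y y0; have [_ _ [[z Zz] _]] := Zirr 0%N id.
  have A0 : \det (GLmx (repr z)) != 0 by rewrite -unitfE -unitmxE GLunit.
  (* Rescaling a lift multiplies its determinant by an [n]-th power, so over a single point the
     determinant takes every nonzero value. *)
  have [t tE] := closed_field_root (y tt / \det (GLmx (repr z))) n0.
  have t0 : t != 0.
    have : t ^+ n != 0 by rewrite tE mulf_neq0 ?invr_eq0.
    by rewrite expf_eq0 n0.
  have utA : t *: GLmx (repr z) \in unitmx by rewrite unitmxZ ?GLunit ?unitfE.
  have tz : toPGL (MkGL utA) = z.
    by rewrite -[RHS]toPGL_repr; apply/toPGL_eqP; exists t.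
  have := ZP _ Zz _ tz; rewrite entriesK detZ tE divfK //.
  by congr (P _ = 0); apply/funext => -[].
have [I [q [cI qP qi]]] := IH (ltnW id).
have [Zi cZi _] := Zirr i (ltnW id); have [_ _ iZ] := Zirr _ id.
have [ZZ /existsNP[z /not_implyP[Zz Ziz]]] := Zlt i id.
have [h [hP Zh]] : exists h, [/\ polyfun h, Z i `<=` vanish h & h (entries (repr z)) != 0].
  by apply: closed_separate; rewrite ?toPGL_repr.
move=> hz; exists (option I), (fun o x => oapp (q^~ x) (h x) o); split.
- by rewrite card_option cI.
- by case.
move=> P PP ZP y0; apply/eqP/negP => /negP Py.
have [k [c [R [cP RP [x cx] PE]]]] := polyfun_order PP Py.
(* The relation factors as [h ^+ k * qc]. As [Z i.+1] is irreducible and [h] is not zero on all of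
   it, [qc] vanishes there; on [Z i], where [h] is 0, this leaves the nontrivial relation [c] among
   the earlier functions. *)
pose qc x := c (fun a => q a x) + h x * R (ocons (h x) (fun a => q a x)).
have cqP : polyfun (fun x => c (fun a => q a x)) by apply: (polyfun_comp cP) => a; apply: qP.
have qcP : polyfun qc.
  apply: polyfun_add => //; apply: polyfun_mul => //.
  by apply: (polyfun_comp RP) => -[a|]; [apply: qP|].
have [|hk|hq] := irreducible_vanish iZ (polyfun_exp k hP) qcP.
- move=> w Zw A Aw; rewrite -PE; have := ZP w Zw A Aw.
  by congr (P _ = 0); apply/funext => -[].
- have /eqP := hk z Zz (repr z) (toPGL_repr z).
  by rewrite expf_eq0 (negbTE hz) andbF.
case/eqP: cx; apply: (qi _ cP) => w Zw A Aw.
have := hq w (ZZ _ Zw) A Aw; rewrite /qc.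
by rewrite (Zh w Zw A Aw) mul0r addr0.
Qed.

(** A longer chain would give more than [#|J|.+1] algebraically independent functions on a cone with
    [#|J|.+1] parameters. *)
Lemma chain_le_card (J : finType) (f : (J -> F) -> M) d Z : (0 < n)%N ->
  polymx f -> family_unit f -> irreducible_chain (image_PGL f) d Z -> (d <= #|J|)%N.
Proof.
move=> n0 fP fU Zc; have [I [q [cI qP qi]]] := chain_independent n0 Zc (leqnn d).
rewrite -ltnS -cI -card_option leqNgt; apply/negP => ltI.
have [|a|P [PP [y Py] Pu]] := @polyfun_dependent _ (option J) I
    (fun z a => q a (entries (cone f z))) => //.
  exact: polyfun_entries_cone.
case/eqP: Py; apply: qi => //; have [/(_ d (leqnn d))[Zd _ _] _] := Zc.
apply: (subset_trans Zd); apply: closure_vanish; first by apply: (polyfun_comp PP) => a; apply: qP.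
by apply/(image_vanish fU) => z _; apply: Pu.
Qed.

(** * Coordinate subtori *)

Section Restriction.
Variables (J : finType) (S : pred J).

Definition extend1 (x : {j | S j} -> F) (j : J) : F := oapp x 1 (insub j).

Lemma extend1_nonvanishing x : nonvanishing x -> nonvanishing (extend1 x).
Proof. by move=> x0 j; rewrite /extend1; case: insub => [k|] /=; rewrite ?oner_neq0. Qed.

Lemma polymx_extend1 (f : (J -> F) -> M) : polymx f -> polymx (f \o extend1).
Proof.
move=> fP k l; apply: (polyfun_comp (fP k l)) => j; rewrite /extend1.
by case: insub => [k'|] /=; [apply: polyfun_var|apply: polyfun_cst].
Qed.

Lemma family_unit_extend1 (f : (J -> F) -> M) :
  family_unit f -> family_unit (f \o extend1).
Proof. by move=> fU x /extend1_nonvanishing/fU. Qed.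

Lemma tangent_extend1 (f : (J -> F) -> M) (E : J -> M) :
  tangent f E -> tangent (f \o extend1) (E \o val).
Proof.
move=> fE v; pose v' j := oapp v 0 (insub j); have [r rP fvE] := fE v'.
exists r => // t; rewrite /comp.
have -> : extend1 (fun j => 1 + t * v j) = fun j => 1 + t * v' j.
  apply/funext => j; rewrite /extend1 /v'.
  by case: insub => //=; rewrite mulr0 addr0.
rewrite fvE; congr (_ + _ *: _ + _).
rewrite (bigID S) /= [X in _ + X]big1 ?addr0; last first.
  by move=> j Sj; rewrite /v' insubN // scale0r.
rewrite (reindex_omap (val : {j | S j} -> J) insub) /=; last by move=> j Sj; rewrite insubT.
apply: eq_big => [j|j _]; first by rewrite valK eqxx andbT (valP j).
by rewrite /v' valK.
Qed.

Lemma lin_indep_extend1 (E : J -> M) :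
  lin_indep (fun o => oapp E 1%:M o) ->
  lin_indep (fun o => oapp (E \o (val : {j | S j} -> J)) 1%:M o).
Proof.
move=> Ei c c0; pose c' o := if o is Some j then oapp (c \o Some) 0 (insub j) else c None.
have /Ei H : \sum_o c' o *: oapp E 1%:M o = 0.
  rewrite -[RHS]c0 !sum_option /=; congr (_ + _).
  rewrite (bigID S) /= [X in _ + X]big1 ?addr0; last first.
    by move=> j Sj; rewrite insubN // scale0r.
  rewrite (reindex_omap (val : {j | S j} -> J) insub) /=; last by move=> j Sj; rewrite insubT.
  apply: eq_big => [j|j _]; first by rewrite valK eqxx andbT (valP j).
  by rewrite valK.
by case=> [j|]; [have := H (Some (val j)); rewrite /= valK|have := H None].
Qed.

End Restriction.

Lemma extend1_image_sub (J : finType) (S S' : pred J) (f : (J -> F) -> M) :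
  subpred S S' ->
  image_PGL (f \o @extend1 J S) `<=` image_PGL (f \o @extend1 J S').
Proof.
move=> SS' _ [x x0 <-]; exists (fun j => extend1 x (val j)).
  by move=> j; apply: extend1_nonvanishing.
congr (toPGL (toGL (f _))); apply/funext => j; rewrite {1}/extend1.
have [j' S'j <- //|S'j] := insubP.
by rewrite /extend1 insubN //=; apply: contra S'j; apply: SS'.
Qed.

Lemma extend1_image (J : finType) (S : pred J) (f : (J -> F) -> M) :
  image_PGL (f \o @extend1 J S) `<=` image_PGL f.
Proof. by move=> _ [x x0 <-]; exists (extend1 x) => //; apply: extend1_nonvanishing. Qed.

Theorem image_dim (J : finType) (f : (J -> F) -> M) (E : J -> M) : (0 < n)%N ->
  polymx f -> family_unit f -> tangent f E -> lin_indep (fun o => oapp E 1%:M o) ->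
  has_dim (image_PGL f) #|J|.
Proof.
move=> n0 fP fU fE Ei; split; last by move=> d Z; apply: chain_le_card.
pose S i := [pred j : J | (enum_rank j < i)%N].
have cS i : (i <= #|J|)%N -> #|{: {j | S i j}}| = i.
  move=> iJ; rewrite card_sig -[RHS]card_ord.
  rewrite -(card_imset _ (f := fun k : 'I_i => enum_val (widen_ord iJ k))); last first.
    by move=> k l /enum_val_inj/(congr1 val) kl; apply: val_inj.
  apply: eq_card => j; rewrite inE /=; apply/idP/imsetP => [ji|[k _ ->]].
    exists (Ordinal ji) => //; rewrite -[LHS]enum_rankK; congr enum_val.
    exact: val_inj.
  by rewrite enum_valK /=.
exists (fun i => closure (image_PGL (f \o @extend1 J (S i)))); split=> i iJ.
  split; [exact/closureS/extend1_image|exact: closed_closure|].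
  by apply: image_irreducible; [exact: polymx_extend1|exact: family_unit_extend1].
split; first by apply/closureS/extend1_image_sub => j /= /ltnW.
move=> H; have : (#|{: {j | S i.+1 j}}| <= #|{: {j | S i j}}|)%N.
  apply: (@image_sub_card _ _ (f \o @extend1 J (S i.+1)) (f \o @extend1 J (S i))
    (E \o val)).
  - exact: polymx_extend1.
  - exact: family_unit_extend1.
  - exact: polymx_extend1.
  - exact: family_unit_extend1.
  - exact: tangent_extend1.
  - exact: lin_indep_extend1.
  - exact: subset_trans (@subset_closure _ _) H.
by rewrite !cS ?ltnn // ltnW.
Qed.

End Dimension.

(** * Generic fibres *)

Section Chevalley.
Variable F : closedFieldType.

Lemma polyfun_term (I : Type) (v : I -> nat) (f : (I -> F) -> F) : polyfun f ->
  exists2 t : GRing.term F, GRing.rterm t &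
    forall e, GRing.eval e t = f (fun i => e`_(v i)).
Proof.
elim=> [c|i|{}f g _ [t rt tE] _ [u ru uE]|{}f g _ [t rt tE] _ [u ru uE]].
- by exists (GRing.Const c).
- by exists (GRing.Var F (v i)).
- by exists (GRing.Add t u) => [|e] /=; rewrite ?rt // tE uE.
- by exists (GRing.Mul t u) => [|e] /=; rewrite ?rt // tE uE.
Qed.

Lemma polyfun_eval (C : Type) (env : (C -> F) -> seq F) (t : GRing.term F) :
  (forall k, polyfun (fun y => (env y)`_k)) -> GRing.rterm t ->
  polyfun (fun y => GRing.eval (env y) t).
Proof.
move=> envP; elim: t => //=.
- by move=> c _; apply: polyfun_cst.
- by move=> k _; apply: polyfun_cst.
- by move=> t IHt u IHu /andP[/IHt tP /IHu uP]; apply: polyfun_add.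
- by move=> t IHt /IHt; apply: polyfun_opp.
- move=> t IHt k /IHt tP; apply: polyfun_ext (polyfun_mul tP (polyfun_cst _ k%:R)) => y.
  by rewrite mulr_natr.
- by move=> t IHt u IHu /andP[/IHt tP /IHu uP]; apply: polyfun_mul.
- by move=> t IHt k /IHt; apply: polyfun_exp.
Qed.

Definition zclosure (I C : Type) (h : (I -> F) -> C -> F) : set (C -> F) :=
  [set y | forall p, polyfun p -> (forall z, p (h z) = 0) -> p y = 0].

(** An equation between polynomials either holds on the whole closure of the image or fails wherever
    their difference is nonzero; for binary connectives the two functions [b] are multiplied. *)
Lemma generic_truth (I C : Type) (h : (I -> F) -> C -> F) (env : (C -> F) -> seq F)
    (phi : GRing.formula F) :
  (forall c, polyfun (fun z => h z c)) -> (forall k, polyfun (fun y => (env y)`_k)) ->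
  GRing.qf_form phi -> GRing.rformula phi ->
  exists (b : (C -> F) -> F) (tau : bool), [/\ polyfun b, exists z, b (h z) != 0 &
    forall y, zclosure h y -> b y != 0 -> GRing.qf_eval (env y) phi = tau].
Proof.
move=> hP envP.
have comb (op : bool -> bool -> bool) phi1 phi2 :
    (exists (b : (C -> F) -> F) (tau : bool), [/\ polyfun b, exists z, b (h z) != 0 &
    forall y, zclosure h y -> b y != 0 -> GRing.qf_eval (env y) phi1 = tau]) ->
    (exists (b : (C -> F) -> F) (tau : bool), [/\ polyfun b, exists z, b (h z) != 0 &
    forall y, zclosure h y -> b y != 0 -> GRing.qf_eval (env y) phi2 = tau]) ->
    exists (b : (C -> F) -> F) (tau : bool), [/\ polyfun b, exists z, b (h z) != 0 &
    forall y, zclosure h y -> b y != 0 ->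
      op (GRing.qf_eval (env y) phi1) (GRing.qf_eval (env y) phi2) = tau].
  move=> [b1 [tau1 [b1P [z1 bz1] E1]]] [b2 [tau2 [b2P [z2 bz2] E2]]].
  exists (fun y => b1 y * b2 y), (op tau1 tau2); split; first exact: polyfun_mul.
    have [z [bz bz']] := polyfun_nz2 (polyfun_comp b1P hP) (polyfun_comp b2P hP) bz1 bz2.
    by exists z; rewrite mulf_neq0.
  move=> y cy; rewrite mulf_eq0 negb_or => /andP[by1 by2].
  by rewrite E1 ?E2.
elim: phi => //=.
- move=> tau _ _; exists (fun=> 1), tau; split=> //; first exact: polyfun_cst.
  by exists (fun=> 0); apply: oner_neq0.
- move=> t u _ /andP[rt ru]; pose d y := GRing.eval (env y) t - GRing.eval (env y) u.
  have dP : polyfun d by apply: polyfun_sub; apply: polyfun_eval.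
  have [[z dz]|d0] := pselect (exists z, d (h z) != 0).
    exists d, false; split=> // [|y _]; first by exists z.
    by rewrite /d subr_eq0 => /negbTE.
  exists (fun=> 1), true; split; first exact: polyfun_cst.
    by exists (fun=> 0); apply: oner_neq0.
  move=> y cy _; rewrite -subr_eq0; apply/eqP; apply: (cy d dP) => z.
  by apply/eqP/negP => /negP dz; apply: d0; exists z.
- move=> f1 IH1 f2 IH2 /andP[q1 q2] /andP[r1 r2].
  by apply: (comb andb); [exact: IH1|exact: IH2].
- move=> f1 IH1 f2 IH2 /andP[q1 q2] /andP[r1 r2].
  by apply: (comb orb); [exact: IH1|exact: IH2].
- move=> f1 IH1 f2 IH2 /andP[q1 q2] /andP[r1 r2].
  by apply: (comb implb); [exact: IH1|exact: IH2].
- move=> f1 IH1 q1 r1.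
  by apply: (comb (fun b _ => ~~ b) f1 f1); exact: IH1.
Qed.

Lemma foldr_And (K : eqType) (s : seq K) (g : K -> GRing.formula F) :
  (forall k, GRing.rformula (g k)) ->
  GRing.rformula (foldr (fun k => GRing.And (g k)) (GRing.Bool true) s) /\
  forall e, GRing.holds e (foldr (fun k => GRing.And (g k)) (GRing.Bool true) s) <->
    forall k, k \in s -> GRing.holds e (g k).
Proof.
move=> gr; elim: s => [|k s [IHr IH]] //=; rewrite gr IHr; split=> // e.
split=> [[gk /IH gs] l|gs]; first by rewrite inE => /predU1P[->|/gs].
split; first by apply: gs; rewrite mem_head.
by apply/IH => l ls; apply: gs; rewrite inE ls orbT.
Qed.

(* Chevalley's theorem; quantifier elimination gives a quantifier-free
   description of the image, whose truth value is generically constant. *)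
Lemma image_constructible (I C : finType) (h : (I -> F) -> C -> F) :
  (forall c, polyfun (fun z => h z c)) ->
  exists b, [/\ polyfun b, exists z, b (h z) != 0 &
    forall y, zclosure h y -> b y != 0 -> exists2 z, nonvanishing z & y = h z].
Proof.
(* Variables below [m] stand for the coordinates of the target, the next [#|I|] for the parameters;
   [phi] quantifies over the latter. *)
move=> hP; pose m := #|C|; pose v (i : I) := (m + enum_rank i)%N.
have /choice[t tP] c : exists t, GRing.rterm t /\
    forall e, GRing.eval e t = h (fun i => e`_(v i)) c.
  by have [t rt tE] := polyfun_term v (hP c); exists t.
pose eqs := foldr (fun c => GRing.And (GRing.Equal (GRing.Var F (enum_rank c)) (t c)))
  (GRing.Bool true) (enum C).
pose neqs := foldr (fun i => GRing.And
    (GRing.Not (GRing.Equal (GRing.Var F (v i)) (GRing.Const 0))))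
  (GRing.Bool true) (enum I).
pose body := GRing.And eqs neqs.
pose phi := foldr (GRing.Exists (R := F)) body (iota m #|I|).
have [eqs_r eqsP] : GRing.rformula eqs /\ forall e, GRing.holds e eqs <->
    forall c, c \in enum C -> e`_(enum_rank c) = GRing.eval e (t c).
  by apply: foldr_And => c /=; have [-> _] := tP c.
have [neqs_r neqsP] : GRing.rformula neqs /\ forall e, GRing.holds e neqs <->
    forall i, i \in enum I -> e`_(v i) <> 0.
  exact: foldr_And.
have phi_r : GRing.rformula phi.
  by rewrite /phi; elim: (iota _ _) => //=; rewrite eqs_r neqs_r.
pose env (y : C -> F) := [seq y c | c <- enum C].
have envE y c : (env y)`_(enum_rank c) = y c.
  by rewrite (nth_map c) ?nth_enum_rank // -cardE ltn_ord.
have envD y k : (m <= k)%N -> (env y)`_k = 0.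
  by move=> mk; rewrite nth_default // size_map -cardE.
have envP k : polyfun (fun y => (env y)`_k).
  have [km|mk] := ltnP k m.
    apply: polyfun_ext (polyfun_var _ (enum_val (Ordinal km))) => y.
    by rewrite -envE enum_valK.
  by apply: polyfun_ext (polyfun_cst _ 0) => y; rewrite envD.
have phiP y : GRing.holds (env y) phi <-> exists2 z, nonvanishing z & y = h z.
  split=> [/GRing.foldExistsP[e eE [/eqsP eq1 /neqsP neq1]]|[z z0 yE]].
    exists (fun i => e`_(v i)) => [i|]; first by apply/eqP/neq1; rewrite mem_enum.
    apply/funext => c; have [_ <-] := tP c; rewrite -eq1 ?mem_enum // -eE ?envE //.
    by rewrite !inE mem_iota negb_and -ltnNge ltn_ord.
  pose e := env y ++ [seq z i | i <- enum I].
  have sE : size (env y) = m by rewrite size_map -cardE.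
  have ez i : e`_(v i) = z i.
    rewrite nth_cat sE /v ltnNge leq_addr /= addKn.
    by rewrite (nth_map i) ?nth_enum_rank // -cardE ltn_ord.
  have ey c : e`_(enum_rank c) = y c by rewrite nth_cat sE ltn_ord envE.
  apply/GRing.foldExistsP; exists e.
    move=> k; rewrite !inE mem_iota negb_and -ltnNge -leqNgt => /orP[km|mk].
      by rewrite nth_cat sE km.
    have mk' : (m <= k)%N := leq_trans (leq_addr _ _) mk.
    by rewrite envD // nth_default // size_cat sE size_map -cardE.
  split.
    apply/eqsP => c _; have [_ ->] := tP c; rewrite ey yE; congr (h _ c).
    by apply/funext.
  by apply/neqsP => i _; rewrite ez; apply/eqP.
pose psi := GRing.quantifier_elim (@ClosedFieldQE.ex_elim F) phi.
have /andP[psi_q psi_r] := GRing.quantifier_elim_wf (@ClosedFieldQE.wf_ex_elim F) phi_r.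
have psiP y := GRing.quantifier_elim_rformP (@ClosedFieldQE.wf_ex_elim F)
  (ClosedFieldQE.holds_ex_elim (@solve_monicpoly F)) (env y) phi_r.
have [b [tau [bP [z1 bz1] bE]]] := generic_truth hP envP psi_q psi_r.
exists b; split=> //; first by exists z1.
have [z z0 bz] := polyfun_nz (polyfun_comp bP hP) bz1.
(* The generic truth value is [true] because it is taken at a point of the image. *)
have tauT : tau.
  rewrite -(bE (h z)) //.
  by apply/psiP/phiP; exists z.
by move=> y cy /(bE _ cy) yE; apply/phiP/psiP; rewrite yE.
Qed.

End Chevalley.

Section GenericFibres.
Variables (F : closedFieldType) (n : nat).
Local Notation M := ('M[F]_n).
Local Notation coord := ('I_n * 'I_n)%type.

Lemma polyfun_nz_prod (I : Type) (J : Type) (s : seq J) (g : J -> (I -> F) -> F) :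
  (forall j, polyfun (g j)) -> (forall j, exists z, g j z != 0) ->
  exists z, \prod_(j <- s) g j z != 0.
Proof.
move=> gP g0; elim: s => [|j s [z IH]].
  by exists (fun=> 0); rewrite big_nil oner_neq0.
have [y gy] := g0 j.
have [x [gx sx]] := polyfun_nz2 (gP j) (polyfun_prod s xpredT gP) gy IH.
by exists x; rewrite big_cons mulf_neq0.
Qed.

Lemma finite_box (J : finType) (r : J -> seq F) :
  finite_set [set x : J -> F | forall j, x j \in r j].
Proof.
pose R := flatten [seq r j | j <- enum J].
pose g (m : {ffun J -> 'I_(size R)}) (j : J) := R`_(m j).
apply: (@sub_finite_set _ _ (g @` setT)); last exact/finite_image/finite_finset.
move=> x xr; have xR j : x j \in R.
  by apply/flatten_mapP; exists j; rewrite ?mem_enum.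
have iR j : (index (x j) R < size R)%N by rewrite index_mem.
exists [ffun j => Ordinal (iR j)] => //.
by apply/funext => j; rewrite /g ffunE /= nth_index.
Qed.

(** A single parameter together with the [#|J|.+1] dual forms makes one function more than the cone
    has parameters, hence a relation [P j]. Over a lift where this relation stays nontrivial in its
    first variable, that parameter has finitely many possible values. *)
Lemma finite_fibres (J : finType) (f : (J -> F) -> M) (E : J -> M) :
  polymx f -> family_unit f -> tangent f E -> lin_indep (fun o => oapp E 1%:M o) ->
  exists c, [/\ polyfun c, exists z, c (entries (cone f z)) != 0 &
    forall A : GL F n, c (entries A) != 0 ->
      finite_set [set x | nonvanishing x /\ toPGL (toGL (f x)) = toPGL A]].
Proof.
move=> fP fU fE Ei; have [L LE] := dual_family Ei.
pose l (A : M) a := \tr (L a *m A).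
have /choice[P PP] j : exists P, [/\ polyfun P, exists y, P y != 0 &
    forall z, P (ocons (z (Some j)) (l (cone f z))) = 0].
  apply: polyfun_dependent; first by rewrite !card_option.
  by case=> [a|]; [exact/polyfun_trace/polymx_cone|exact: polyfun_var].
(* Fixing the first variable at [T j] keeps [P j] nonzero as a function of the forms; where its
   value is nonzero, [P j] is nontrivial in the first variable. *)
have /choice[T TP] j : exists T, exists y, P j (ocons T y) != 0.
  by have [_ [y Py] _] := PP j; exists (y None), (y \o Some); rewrite -oconsE.
pose cj j x := P j (ocons (T j) (l (mx_of x))).
have cjP j : polyfun (cj j).
  have [PjP _ _] := PP j; apply: (polyfun_comp PjP) => -[a|]; last exact: polyfun_cst.
  exact/polyfun_trace/polymx_mx_of.
exists (fun x => \prod_j cj j x); split.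
- exact: polyfun_prod.
- apply: (@polyfun_nz_prod _ _ _ (fun j z => cj j (entries (cone f z)))) => j.
    exact: polyfun_entries_cone.
  have [PjP _ _] := PP j; have [y Py] := TP j.
  have QP : polyfun (fun y => P j (ocons (T j) y)).
    by apply: (polyfun_comp PjP) => -[a|]; [exact: polyfun_var|exact: polyfun_cst].
  have [z _ Qz] := polyfun_tangent_nz (polymx_cone fP) (tangent_cone fE) LE QP Py.
  by exists z; rewrite /cj entriesK.
move=> A cA.
have /choice[r rP] j : exists r : seq F, forall t, P j (ocons t (l A)) = 0 -> t \in r.
  have [PjP _ _] := PP j; have [p pE] := polyfun_upoly (l A) PjP.
  have p0 : p != 0.
    apply: contra_neq cA => p0; rewrite (bigD1 j) //= /cj entriesK pE p0.
    by rewrite horner0 mul0r.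
  have [r pr] := closed_field_poly_normal p; exists r => t.
  rewrite pE => /rootP; rewrite pr rootZ ?lead_coef_eq0 //.
  by rewrite root_prod_XsubC.
apply: sub_finite_set (finite_box r) => x [x0 xA] j; apply: rP.
have [c c0 ->] := cone_lift fU x0 (esym xA).
by have [_ _ /(_ (ocons c x))] := PP j.
Qed.

(** Where [b * c] is nonzero at some lift, [b] places the points of the closure in the image and [c]
    makes their fibres finite. *)
Theorem image_generic_fibres (J : finType) (f : (J -> F) -> M) (E : J -> M) :
  polymx f -> family_unit f -> tangent f E -> lin_indep (fun o => oapp E 1%:M o) ->
  generically (image_PGL f)
    (fun g => finite_set [set x | nonvanishing x /\ toPGL (toGL (f x)) = g]).
Proof.
move=> fP fU fE Ei.
have [c [cP [y cy] cfin]] := finite_fibres fP fU fE Ei.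
have hP ij : polyfun (fun z => entries (cone f z) ij) by exact: polymx_cone.
have [b [bP [z bz] bE]] := image_constructible hP.
have bcP : polyfun (fun x => b x * c x) by exact: polyfun_mul.
have [w [bw cw]] := polyfun_nz2 (polyfun_entries_cone fP bP)
  (polyfun_entries_cone fP cP) bz cy.
have [{bw cw}w w0 bcw] := polyfun_nz (polyfun_entries_cone fP bcP) (mulf_neq0 bw cw).
have lift z' : (~` vanish (fun x => b x * c x) `&` closure (image_PGL f)) z' ->
    exists A : GL F n, [/\ toPGL A = z', b (entries A) != 0, c (entries A) != 0
      & zclosure (fun z => entries (cone f z)) (entries A)].
  move=> [/existsNP[A /not_implyP[Az /eqP]]].
  rewrite mulf_eq0 negb_or => /andP[bA cA] cz; exists A; split=> // p pP p0.
  have fp : image_PGL f `<=` vanish p by apply/(image_vanish fU).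
  exact: (closure_vanish pP fp cz).
exists (~` vanish (fun x => b x * c x) `&` closure (image_PGL f)); split.
- have wE : GLmx (toGL (cone f w)) = cone f w by apply/toGLK/cone_unit.
  exists (toPGL (toGL (cone f w))); split.
    by move=> /(_ _ erefl)/eqP; rewrite wE (negbTE bcw).
  apply: subset_closure; exists (w \o Some); last by rewrite toPGL_cone.
  by move=> j; apply: w0.
- move=> z' /lift[A [<- bA cA /bE/(_ bA)[u u0 AE]]].
  have -> : A = toGL (cone f u).
    by rewrite -[A]GLmxK -[GLmx A]entriesK AE entriesK.
  by rewrite toPGL_cone //; exists (u \o Some) => // j; apply: u0.
- by exists (~` vanish (fun x => b x * c x)) => //; apply: open_nonvanish.
- by move=> z' /lift[A [<- _ /cfin]].
Qed.

End GenericFibres.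

(** * Products of conjugates of the diagonal torus *)

Lemma sum_pair (V : nmodType) (I J : finType) (f : I * J -> V) :
  \sum_ij f ij = \sum_i \sum_j f (i, j).
Proof. by rewrite pair_bigA; apply: eq_bigr => -[]. Qed.

Section ConjugateTori.
Variables (F : closedFieldType) (n : nat).
Local Notation M := ('M[F]_n.+1).
Local Notation G := (PGL F n.+1).

(** The last diagonal entry is normalised to 1, so that each class of invertible diagonal matrices
    modulo scalars has exactly one parameter. *)
Definition dvec (x : 'I_n -> F) : 'rV[F]_n.+1 := \row_k oapp x 1 (unlift ord_max k).

Definition dconj (B : M) (x : 'I_n -> F) : M := invmx B *m diag_mx (dvec x) *m B.

(* The derivatives of [dconj B] at [1]. *)
Definition dconjE (B : M) (j : 'I_n) : M :=
  invmx B *m delta_mx (lift ord_max j) (lift ord_max j) *m B.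

Definition torus (B : M) : set G := image_PGL (dconj B).

Lemma polymx_mul (J : Type) (f g : (J -> F) -> M) :
  polymx f -> polymx g -> polymx (fun x => f x *m g x).
Proof.
move=> fP gP k l; have := polyfun_sum (index_enum 'I_n.+1) xpredT
  (fun i => polyfun_mul (fP k i) (gP i l)).
by apply: polyfun_ext => x; rewrite mxE.
Qed.

Lemma polymx_cst (J : Type) (A : M) : polymx (fun _ : J -> F => A).
Proof. by move=> k l; apply: polyfun_cst. Qed.

Lemma polymx_dconj B : polymx (dconj B).
Proof.
apply: polymx_mul (polymx_cst _ B); apply: polymx_mul (polymx_cst _ _) _ => k l.
apply: (@polyfun_ext _ _ (fun x : 'I_n -> F => oapp x 1 (unlift ord_max l) * (k == l)%:R)).
  by move=> x; rewrite !mxE mulr_natr; case: eqP => [->|]; rewrite ?mulr0n.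
apply: polyfun_mul (polyfun_cst _ _).
by case: unlift => [j|] /=; [apply: polyfun_var|apply: polyfun_cst].
Qed.

Lemma dvec_nonvanishing x k : nonvanishing x -> dvec x 0 k != 0.
Proof. by move=> x0; rewrite mxE; case: unlift => [j|] /=; rewrite ?oner_neq0. Qed.

Lemma unitmx_diag (d : 'rV[F]_n.+1) : (forall k, d 0 k != 0) -> diag_mx d \in unitmx.
Proof. by move=> d0; rewrite unitmxE det_diag unitfE; apply/prodf_neq0. Qed.

Lemma dconj_unit B : B \in unitmx -> family_unit (dconj B).
Proof.
move=> uB x x0; rewrite !unitmx_mul unitmx_inv uB andbT /=.
by apply: unitmx_diag => k; apply: dvec_nonvanishing.
Qed.

Lemma tangent_dconj B : B \in unitmx -> tangent (dconj B) (dconjE B).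
Proof.
move=> uB v; exists (fun=> 0) => [k l|t]; first by rewrite mxE; apply: upoly_cst.
have -> : \sum_j v j *: dconjE B j =
    invmx B *m (\sum_j v j *: delta_mx (lift ord_max j) (lift ord_max j)) *m B.
  rewrite mulmx_sumr mulmx_suml; apply: eq_bigr => j _.
  by rewrite -scalemxAr -scalemxAl.
rewrite scaler0 addr0; set S := \sum_j _ *: _.
suff -> : dconj B (fun j => 1 + t * v j) = invmx B *m (1%:M + t *: S) *m B.
  by rewrite mulmxDr mulmx1 mulmxDl mulVmx // -scalemxAr -scalemxAl.
congr (_ *m _ *m _); rewrite /S {S}.
apply/matrixP => k l; rewrite !mxE summxE.
under eq_bigr do rewrite !mxE.
case: (unliftP ord_max k) => [j ->|->] /=.
  rewrite (bigD1 j) //= big1 ?addr0; last first.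
    by move=> i /negbTE ij; rewrite (inj_eq lift_inj) eq_sym ij mulr0.
  rewrite eqxx /= [l == _]eq_sym.
  by case: eqP => _; rewrite ?mulr1n ?mulr0n ?mulr1 // !mulr0 addr0.
rewrite big1 ?mulr0 ?addr0 // => j _.
by rewrite (negbTE (neq_lift _ _)) mulr0.
Qed.


Section TorusProduct.
Variables (s : nat) (B : 'I_s -> M).
Hypothesis uB : forall i, B i \in unitmx.

Definition torus_prod (x : 'I_s * 'I_n -> F) : M :=
  \big[mulmx/1%:M]_(i < s) dconj (B i) (fun j => x (i, j)).

Definition torus_tangent (ij : 'I_s * 'I_n) : M := dconjE (B ij.1) ij.2.

Lemma polymx_torus_prod : polymx torus_prod.
Proof.
rewrite /torus_prod; elim: (index_enum _) => [|i r IH] k l.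
  by apply: polyfun_ext (polyfun_cst _ ((1%:M : M) k l)) => x; rewrite big_nil.
have dP : polymx (fun x : 'I_s * 'I_n -> F => dconj (B i) (fun j => x (i, j))).
  by move=> k' l'; apply: (polyfun_comp (polymx_dconj (B i) k' l')) => j; apply: polyfun_var.
by apply: polyfun_ext (polymx_mul dP IH k l) => x; rewrite big_cons.
Qed.

Lemma torus_prodE x : nonvanishing x -> toGL (torus_prod x) =
  (\prod_(i < s) toGL (dconj (B i) (fun j => x (i, j))))%g.
Proof.
move=> x0.
suff E : torus_prod x = GLmx (\prod_(i < s) toGL (dconj (B i) (fun j => x (i, j))))%g.
  by rewrite E GLmxK.
rewrite (big_morph (@GLmx F n.+1) (id1 := 1%:M) (op1 := mulmx)) //.
by apply: eq_bigr => i _; rewrite toGLK //; apply: dconj_unit => // j; apply: x0.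
Qed.

Lemma toPGL_torus_prod x : nonvanishing x -> toPGL (toGL (torus_prod x)) =
  (\prod_(i < s) toPGL (toGL (dconj (B i) (fun j => x (i, j)))))%g.
Proof. by move=> x0; rewrite torus_prodE //; apply: (big_morph _ (@toPGLM F n.+1)). Qed.

Lemma family_unit_torus_prod : family_unit torus_prod.
Proof.
move=> x x0; rewrite /torus_prod; elim: (index_enum _) => [|i r IH].
  by rewrite big_nil unitmx1.
rewrite big_cons unitmx_mul IH andbT; apply: dconj_unit => // j; exact: x0.
Qed.

Lemma tangent_torus_prod : tangent torus_prod torus_tangent.
Proof.
pose E i (ij : 'I_s * 'I_n) := if ij.1 == i then dconjE (B i) ij.2 else 0.
have fE i : tangent (fun x => dconj (B i) (fun j => x (i, j))) (E i).
  move=> v; have [r rP vE] := tangent_dconj (uB i) (fun j => v (i, j)).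
  exists r => // t; rewrite vE; congr (_ + _ *: _ + _).
  rewrite sum_pair (bigD1 i) //=.
  rewrite [X in _ + X]big1 ?addr0 => [|i' ii'].
    by apply: eq_bigr => j _; rewrite /E eqxx.
  by apply: big1 => j _; rewrite /E /= (negbTE ii') scaler0.
move=> v; have [r rP vE] := tangent_prod (index_enum 'I_s) fE v.
exists r => // t; rewrite /torus_prod vE; congr (_ + _ *: _ + _); apply: eq_bigr => -[i j] _.
congr (_ *: _); rewrite (bigD1 i) //= big1 ?addr0 => [|i' ii'].
  by rewrite /E eqxx.
by rewrite /E /= eq_sym (negbTE ii').
Qed.

Lemma prod_set_torus : prod_set (fun i => torus (B i)) = image_PGL torus_prod.
Proof.
rewrite eqEsubset; split=> [g [t [tT ->]]|_ [x x0 <-]].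
  have /choice[x xP] i : exists x, nonvanishing x /\ toPGL (toGL (dconj (B i) x)) = t i.
    by have [x x0 xt] := tT i; exists x.
  have x0 : nonvanishing (fun ij => x ij.1 ij.2).
    by move=> ij; have [x0 _] := xP ij.1; apply: x0.
  exists (fun ij => x ij.1 ij.2) => //; rewrite toPGL_torus_prod //.
  by apply: eq_bigr => i _; have [_ <-] := xP i.
exists (fun i => toPGL (toGL (dconj (B i) (fun j => x (i, j))))); split.
  by move=> i; exists (fun j => x (i, j)) => // j; apply: x0.
exact: toPGL_torus_prod.
Qed.

Lemma finite_torus_decompositions g :
  finite_set [set x | nonvanishing x /\ toPGL (toGL (torus_prod x)) = g] ->
  finite_set (decompositions (fun i => torus (B i)) g).
Proof.
pose d (x : 'I_s * 'I_n -> F) i := toPGL (toGL (dconj (B i) (fun j => x (i, j)))).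
move=> /(finite_image d); apply: sub_finite_set => t [tT gE].
have /choice[x xP] i : exists x, nonvanishing x /\ toPGL (toGL (dconj (B i) x)) = t i.
  by have [x x0 xt] := tT i; exists x.
have x0 : nonvanishing (fun ij => x ij.1 ij.2).
  by move=> ij; have [x0 _] := xP ij.1; apply: x0.
have xt : d (fun ij => x ij.1 ij.2) = t.
  by apply/funext => i; have [_ <-] := xP i.
exists (fun ij => x ij.1 ij.2) => //; split=> //.
rewrite toPGL_torus_prod // gE; apply: eq_bigr => i _.
by rewrite -xt.
Qed.

Theorem independent_tori :
  lin_indep (fun o => oapp torus_tangent 1%:M o) ->
  (exists d : 'I_s -> nat, (forall i, has_dim (torus (B i)) (d i)) /\
     has_dim (prod_set (fun i => torus (B i))) (\sum_(i < s) d i)%N) /\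
  generically (prod_set (fun i => torus (B i)))
    (fun g => finite_set (decompositions (fun i => torus (B i)) g)).
Proof.
move=> Ei; split; last first.
  have [W [W0 WA WV WP]] := image_generic_fibres polymx_torus_prod
    family_unit_torus_prod tangent_torus_prod Ei.
  exists W; rewrite prod_set_torus; split=> // g /WP; exact: finite_torus_decompositions.
exists (fun=> n); split=> [i|].
  rewrite -[n in has_dim _ n]card_ord.
  apply: (image_dim _ (polymx_dconj _) (dconj_unit _) (tangent_dconj _)) => // c c0.
  (* A relation among the tangent vectors of one torus is a relation in the whole family, with zero
     coefficients at the other tori. *)
  pose c' o := if o is Some ij then if ij.1 == i then c (Some ij.2) else 0 else c None.
  have /Ei H : \sum_o c' o *: oapp torus_tangent 1%:M o = 0.
    rewrite -[RHS]c0 !sum_option /=; congr (_ + _).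
    rewrite sum_pair (bigD1 i) //= [X in _ + X]big1 ?addr0 => [|i' ii'].
      by apply: eq_bigr => j _; rewrite eqxx.
    by apply: big1 => j _; rewrite (negbTE ii') scale0r.
  by case=> [j|]; [have := H (Some (i, j)); rewrite /= eqxx|have := H None].
have -> : (\sum_(i < s) n)%N = #|{: 'I_s * 'I_n}| by rewrite sum_nat_const card_prod !card_ord.
rewrite prod_set_torus; apply: (image_dim _ polymx_torus_prod) tangent_torus_prod Ei => //.
exact: family_unit_torus_prod.
Qed.

End TorusProduct.

End ConjugateTori.

(** * Conjugates of the diagonal torus are tori *)

Section TorusIsTorus.
Variables (F : closedFieldType) (n : nat).
Local Notation M := ('M[F]_n.+1).
Local Notation G := (PGL F n.+1).
Local Notation coord := ('I_n.+1 * 'I_n.+1)%type.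
Variable B : M.
Hypothesis uB : B \in unitmx.

Definition torus_param (x : 'I_n -> F) : G := toPGL (toGL (dconj B x)).

(** The membership criterion behind both closedness and diagonalisation: dividing by the last
    diagonal entry reaches the normalised form. *)
Lemma torus_diag (A : GL F n.+1) (d : 'rV[F]_n.+1) :
  B *m A = diag_mx d *m B -> torus B (toPGL A).
Proof.
move=> BA; have AE : GLmx A = invmx B *m diag_mx d *m B by rewrite -mulmxA -BA mulKmx.
have d0 k : d 0 k != 0.
  have : \det (diag_mx d) != 0.
    rewrite -unitfE -unitmxE; have : diag_mx d *m B \in unitmx.
      by rewrite -BA unitmx_mul uB GLunit.
    by rewrite unitmx_mul uB andbT.
  by rewrite det_diag; apply: contra_neq => dk; rewrite (bigD1 k) //= dk mul0r.
pose x j := d 0 (lift ord_max j) / d 0 ord_max.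
have x0 : nonvanishing x by move=> j; rewrite mulf_neq0 ?invr_eq0.
exists x => //; apply/esym/toPGL_eqP; exists (d 0 ord_max) => //.
rewrite toGLK ?dconj_unit // AE /dconj scalemxAl scalemxAr; congr (_ *m _ *m _).
apply/matrixP => k l; rewrite !mxE mulrnAr; congr (_ *+ _).
by case: unliftP => [j ->|->] /=; rewrite ?mulr1 // mulrC divfK.
Qed.

Lemma dconjM x y : dconj B x *m dconj B y = dconj B (fun i => x i * y i).
Proof.
rewrite /dconj !mulmxA; congr (_ *m _); rewrite mulmxK // -mulmxA; congr (_ *m _).
rewrite mulmx_diag; congr diag_mx; apply/rowP => k; rewrite !mxE.
by case: unlift => //=; rewrite mulr1.
Qed.

Lemma dconj1 : dconj B (fun=> 1) = 1%:M.
Proof.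
rewrite /dconj; suff -> : diag_mx (dvec (fun _ : 'I_n => 1 : F)) = 1%:M.
  by rewrite mulmx1 mulVmx.
rewrite -diag_const_mx; congr diag_mx; apply/rowP => k; rewrite !mxE.
by case: unlift.
Qed.

Lemma det_dconj x : \det (dconj B x) = \prod_j x j.
Proof.
rewrite !det_mulmx mulrAC -det_mulmx mulVmx // det1 mul1r det_diag.
rewrite (bigD1 ord_max) //= mxE unlift_none /= mul1r.
rewrite (reindex_omap (lift ord_max) (unlift ord_max)) /=; last first.
  by move=> k; case: unliftP => [j ->|->]; rewrite ?eqxx.
apply: eq_big => [j|j _]; first by rewrite eq_sym neq_lift liftK eqxx.
by rewrite mxE liftK.
Qed.

Lemma torus_paramM x y : nonvanishing x -> nonvanishing y ->
  torus_param (fun i => x i * y i) = (torus_param x * torus_param y)%g.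
Proof.
move=> x0 y0; rewrite /torus_param -toPGLM; congr toPGL; apply: val_inj.
rewrite /= !toGLK ?dconj_unit ?dconjM // => j; exact: mulf_neq0.
Qed.

Lemma torus_param1 : torus_param (fun=> 1) = 1%g.
Proof.
rewrite /torus_param dconj1; congr toPGL; apply: val_inj.
by rewrite /= toGLK ?unitmx1.
Qed.

Lemma subgroup_torus : subgroup (torus B).
Proof.
split.
- by exists (fun=> 1) => [j|]; [apply: oner_neq0|apply: torus_param1].
- move=> _ _ [x x0 <-] [y y0 <-]; exists (fun i => x i * y i).
    by move=> j; apply: mulf_neq0.
  exact: torus_paramM.
- move=> _ [x x0 <-].
  have x0' : nonvanishing (fun i => (x i)^-1) by move=> j; rewrite invr_eq0.
  exists (fun i => (x i)^-1) => //; apply: (mulgI (torus_param x)).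
  rewrite -/(torus_param _) -torus_paramM // mulgV -torus_param1; congr torus_param.
  by apply/funext => j; rewrite divff.
Qed.

Lemma dconj_diag x : B *m dconj B x = diag_mx (dvec x) *m B.
Proof. by rewrite /dconj !mulmxA mulmxV // mul1mx. Qed.

Lemma closed_torus : closed (torus B).
Proof.
pose p (kl : coord) (x : coord -> F) := (B *m mx_of x *m invmx B) kl.1 kl.2.
have pP kl : polyfun (p kl).
  apply: polymx_mul (polymx_cst _ _) _ _; apply: polymx_mul (polymx_cst _ _) _.
  exact: polymx_mx_of.
suff -> : torus B = \bigcap_(kl in [set kl : coord | kl.1 != kl.2]) vanish (p kl).
  by apply: closed_bigI => kl _; apply: closed_vanish.
rewrite eqEsubset; split=> [_ [x x0 <-] [k l] /= kl A AE|z zp].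
  have [c c0 ->] := toPGL_lift AE; rewrite /p entriesK toGLK ?dconj_unit //=.
  by rewrite -scalemxAr dconj_diag -scalemxAl mulmxK // !mxE (negbTE kl) mulr0.
rewrite -[z]toPGL_repr.
apply: (@torus_diag _ (\row_k (B *m GLmx (repr z) *m invmx B) k k)).
rewrite -[LHS](mulmxKV uB); congr (_ *m _); apply/matrixP => k l; rewrite [RHS]mxE [X in _ = X *+ _]mxE.
have [<-|kl] := eqVneq k l; first by rewrite mulr1n.
by rewrite mulr0n; have := zp (k, l) kl (repr z) (toPGL_repr z); rewrite /p entriesK.
Qed.

Lemma regular_comp (I : finType) (q : (I -> F) -> F) (r : I -> (coord -> F) -> F) :
  polyfun q -> (forall i, polyfun (r i)) ->
  exists (p : (coord -> F) -> F) k, polyfun p /\ forall A : GL F n.+1,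
    q (fun i => r i (entries A) / \det A) = p (entries A) / \det A ^+ k.
Proof.
move=> qP rP; have dP : polyfun (fun x => \det (mx_of x : M)).
  exact/polyfun_det/polymx_mx_of.
have d0 (A : GL F n.+1) : \det A != 0 by rewrite -unitfE -unitmxE GLunit.
elim: qP => [c|i|f g _ [p [k [pP fE]]] _ [p' [k' [p'P gE]]]
  |f g _ [p [k [pP fE]]] _ [p' [k' [p'P gE]]]].
- exists (fun=> c), 0%N; split=> [|A]; first exact: polyfun_cst.
  by rewrite expr0 divr1.
- by exists (r i), 1%N.
- exists (fun x => p x * \det (mx_of x : M) ^+ k' + p' x * \det (mx_of x : M) ^+ k), (k + k')%N.
  split; first by apply: polyfun_add; apply: polyfun_mul => //; apply: polyfun_exp.
  move=> A; rewrite fE gE entriesK exprD addf_div ?expf_neq0 //.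
- exists (fun x => p x * p' x), (k + k')%N; split; first exact: polyfun_mul.
  by move=> A; rewrite fE gE exprD mulf_div.
Qed.

(* The coordinate functions of the torus extend to [PGL] as quotients of forms
   of degree [n.+1] by the determinant. *)
Lemma torus_iso_param : torus_iso torus_param (torus B).
Proof.
have phiG x : nonvanishing x -> GLmx (toGL (dconj B x)) = dconj B x.
  by move=> x0; rewrite toGLK ?dconj_unit.
split; first split.
- by move=> x x0; exists x.
- move=> x y /set_mem x0 /set_mem y0 /toPGL_lift[c c0].
  rewrite !phiG // => /(congr1 (mulmx B)); rewrite -scalemxAr !dconj_diag scalemxAl.
  move=> /(congr1 (mulmx^~ (invmx B))); rewrite !mulmxK // => /matrixP xy.
  have c1 : c = 1.
    by have := xy ord_max ord_max; rewrite !mxE unlift_none eqxx !mulr1n mulr1.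
  apply/funext => j; have := xy (lift ord_max j) (lift ord_max j).
  by rewrite !mxE liftK eqxx !mulr1n c1 mul1r.
- by move=> _ [x x0 <-]; exists x.
- exact: torus_paramM.
move=> f; split=> [[g [p [k gE]] fg]|[q [k fE]]].
  have [q qE] : exists q : mpoly #|{: 'I_n}| F, forall x,
      peval p (entries (dconj B x)) = peval q (x : affine F 'I_n).
    apply: peval_polyfun; apply: (polyfun_comp (polyfun_peval p)) => ij.
    exact: polymx_dconj.
  exists q, k => x x0; rewrite /= fg; last by exists x.
  by rewrite gE phiG // det_dconj -qE; congr (peval p _ / _); rewrite /GLentries phiG.
pose C (x : coord -> F) : M := B *m mx_of x *m invmx B.
have CP k' l' : polyfun (fun x => C x k' l').
  by apply: polymx_mul (polymx_cst _ _) _ _; apply: polymx_mul (polymx_cst _ _) (@polymx_mx_of _ _).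
pose D x j := C x (lift ord_max j) (lift ord_max j).
have DP j : polyfun (D^~ j) by exact: CP.
(* At [dconj B x] the diagonal entries [D] are the [x j] and the determinant is their product, so
   [r (Some j)] over the determinant is [x j], while [r None] over it is the inverse of that product
   and supplies the denominator of [f]. *)
pose r (o : option 'I_n) x := if o is Some j then D x j * \prod_i D x i
  else C x ord_max ord_max ^+ n.+1.
have rP o : polyfun (r o).
  case: o => [j|]; last exact: polyfun_exp.
  by apply: polyfun_mul => //; apply: polyfun_prod.
pose Q (z : option 'I_n -> F) := peval q (z \o Some : affine F 'I_n) * z None ^+ k.
have QP : polyfun Q.
  apply: polyfun_mul; last exact/polyfun_exp/polyfun_var.
  by apply: (polyfun_comp (polyfun_peval q)) => j; apply: polyfun_var.
pose R (A : GL F n.+1) := Q (fun o => r o (entries A) / \det A).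
have RZ (A A' : GL F n.+1) : toPGL A = toPGL A' -> R A = R A'.
  move=> /toPGL_lift[c c0 AE]; congr Q; apply/funext => o.
  have CZ k' l' : C (entries A) k' l' = c * C (entries A') k' l'.
    by rewrite /C !entriesK AE -scalemxAr -scalemxAl mxE.
  have -> : r o (entries A) = c ^+ n.+1 * r o (entries A').
    case: o => [j|] /=; last by rewrite CZ exprMn.
    rewrite /D CZ; under eq_bigr do rewrite CZ.
    by rewrite big_split /= prodr_const card_ord exprS; ring.
  by rewrite AE detZ -mulf_div divff ?mul1r // expf_neq0.
exists (fun z => R (repr z)).
  have [p [k' [pP pE]]] := regular_comp QP rP.
  have [p' p'E] := peval_polyfun pP; exists p', k' => A.
  by rewrite (RZ _ A) ?toPGL_repr // /R pE p'E.
move=> _ [x x0 <-]; rewrite (RZ _ (toGL (dconj B x))) ?toPGL_repr //.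
rewrite -/(torus_param x) [LHS](fE x x0) /R /Q /= phiG // det_dconj.
have CE k' : C (entries (dconj B x)) k' k' = dvec x 0 k'.
  by rewrite /C entriesK dconj_diag mulmxK // !mxE eqxx mulr1n.
have DE j : D (entries (dconj B x)) j = x j by rewrite /D CE mxE liftK.
have px : \prod_i x i != 0 by apply/prodf_neq0 => i _; apply: x0.
congr (peval q _ * _).
  apply/funext => j /=; rewrite DE; under eq_bigr do rewrite DE.
  by rewrite mulfK.
by rewrite CE mxE unlift_none /= expr1n mul1r exprVn.
Qed.

Lemma is_torus_torus : is_torus (torus B).
Proof.
split; [exact: subgroup_torus|exact: closed_torus|].
by exists n, torus_param; apply: torus_iso_param.
Qed.

Lemma conj_torus (A : GL F n.+1) : conj_set (torus B) (toPGL A) = torus (B *m A).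
Proof.
have conjE x : nonvanishing x ->
    (torus_param x ^ toPGL A)%g = toPGL (toGL (dconj (B *m A) x)).
  move=> x0; rewrite /conjg /torus_param -toPGLV -(toPGLM _ A) -toPGLM; congr toPGL; apply: val_inj.
  have uBA : B *m A \in unitmx by rewrite unitmx_mul uB GLunit.
  rewrite /= !toGLK ?dconj_unit // /dconj.
  suff -> : invmx (B *m A) = invmx A *m invmx B by rewrite !mulmxA.
  apply: (can_inj (mulmxK uBA)); rewrite mulVmx // -mulmxA mulKmx //.
  by rewrite mulVmx ?GLunit.
rewrite eqEsubset; split=> [_ [_ [x x0 <-] <-]|_ [x x0 <-]].
  by exists x; rewrite // -conjE.
by exists (torus_param x); [exists x|apply: conjE].
Qed.

End TorusIsTorus.

(** * Diagonalisation of tori *)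

Section Dedekind.
Variable F : closedFieldType.

Definition monomial (N : nat) (m : multinom N) (x : 'I_N -> F) : F := \prod_i x i ^+ m i.

Lemma monomialM N (m : multinom N) x y :
  monomial m (fun i => x i * y i) = monomial m x * monomial m y.
Proof. by rewrite -big_split; apply: eq_bigr => i _; rewrite exprMn. Qed.

Lemma monomial_nz N (m : multinom N) x : nonvanishing x -> monomial m x != 0.
Proof. by move=> x0; apply/prodf_neq0 => i _; rewrite expf_neq0. Qed.

Lemma monomial_neq N (m m' : multinom N) : m != m' ->
  exists2 x : 'I_N -> F, nonvanishing x & monomial m x != monomial m' x.
Proof.
move=> mm'; have [i mi] : exists i, m i != m' i.
  apply/not_existsP => H; case/eqP: mm'; apply/mnmP => i.
  by apply/eqP/negP => /negP /H.
have p0 : 'X^(m i) - 'X^(m' i) != 0 :> {poly F}.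
  apply: contra mi; rewrite subr_eq0 => /eqP/(congr1 (fun p : {poly F} => size p)).
  by rewrite !size_polyXn => -[->].
have /closed_nonrootP[t] : 'X * ('X^(m i) - 'X^(m' i)) != 0 :> {poly F}.
  by rewrite mulf_neq0 ?polyX_eq0.
rewrite rootM negb_or rootX => /andP[t0].
rewrite /root !hornerE subr_eq0 => tm.
pose x (j : 'I_N) := if j == i then t else 1.
have xE k : monomial k x = t ^+ k i.
  rewrite /monomial (bigD1 i) //= /x eqxx big1 ?mulr1 // => j /negbTE ->.
  by rewrite expr1n.
exists x; last by rewrite !xE.
by move=> j; rewrite /x; case: (j == i); rewrite ?oner_neq0.
Qed.

(** Dedekind's argument: evaluate the relation at [x * y] and subtract [monomial m y] times the
    relation at [x]. This removes [m] and multiplies the coefficient of [m'] by a factor that a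
    suitable [y] makes nonzero. *)
Lemma monomials_independent N (s : seq (multinom N)) (c : multinom N -> F) :
  uniq s -> (forall x, nonvanishing x -> \sum_(m <- s) c m * monomial m x = 0) ->
  forall m, m \in s -> c m = 0.
Proof.
elim: s c => [//|m s IH] c /andP[ms us] c0.
have cs m' : m' \in s -> c m' = 0.
  move=> m's; have mm' : m' != m by apply: contraNneq ms => <-.
  have [y y0 ym] := monomial_neq mm'.
  have /IH/(_ m' m's)/eqP : forall x, nonvanishing x ->
      \sum_(k <- s) c k * (monomial k y - monomial m y) * monomial k x = 0.
    move=> x x0; have := c0 _ (fun i => mulf_neq0 (x0 i) (y0 i)).
    have := c0 x x0; rewrite !big_cons => /(congr1 ( *%R^~ (monomial m y))).
    rewrite mul0r mulrDl mulr_suml => E1 E2.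
    rewrite (eq_bigr (fun k => c k * monomial k (fun i => x i * y i) -
      c k * monomial k x * monomial m y)); last by move=> k _; rewrite monomialM; ring.
    apply/eqP; rewrite sumrB subr_eq0; apply/eqP.
    apply: (addrI (c m * monomial m x * monomial m y)); rewrite E1 -[RHS]E2.
    by rewrite monomialM mulrA.
  by rewrite mulf_eq0 subr_eq0 (negbTE ym) orbF => /(_ us)/eqP.
have cm : c m = 0.
  have := c0 (fun=> 1) (fun=> oner_neq0 F); rewrite big_cons big_seq big1 => [|k ks].
    move/eqP; rewrite addr0 mulf_eq0 (negbTE (monomial_nz _ (fun=> oner_neq0 F))) orbF.
    by move/eqP.
  by rewrite cs ?mul0r.
by move=> k; rewrite inE => /predU1P[->|/cs].
Qed.

End Dedekind.

Section CommonEigenvector.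
Variables (F : closedFieldType) (n : nat).
Local Notation M := ('M[F]_n.+1).

(* A stable subspace of minimal rank lies in an eigenspace of each matrix. *)
Lemma common_left_eigenvector (S : set M) :
  (forall A B, S A -> S B -> A *m B = B *m A) ->
  exists2 w : 'rV[F]_n.+1, w != 0 & forall A, S A -> exists a, w *m A = a *: w.
Proof.
move=> SC.
pose stable (V : M) := V != 0 /\ forall A, S A -> (V *m A <= V)%MS.
have exk : exists k, `[< exists V, stable V /\ \rank V = k >].
  exists (\rank (1%:M : M)); apply/asboolP; exists 1%:M; split=> //; split=> [|A _].
    by rewrite -mxrank_eq0 mxrank1.
  exact: submx1.
have [k /asboolP[V [[V0 VS] Vk]] kmin] := ex_minnP exk.
have [w wV w0] := rowV0Pn V0; exists w => // A SA.
have /submxP[R RE] : (row_base V *m A <= row_base V)%MS.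
  by rewrite (eqmxMr A (eq_row_base V)) eq_row_base VS.
have /closed_rootP[a] : size (char_poly R) != 1%N.
  by rewrite size_char_poly eqSS mxrank_eq0.
rewrite -eigenvalue_root_char => /eigenvalueP[u uR u0].
pose W := (V :&: eigenspace A a)%MS.
have W0 : W != 0.
  apply/rowV0Pn; exists (u *m row_base V).
    rewrite sub_capmx; apply/andP; split.
      by rewrite -(eq_row_base V) submxMl.
    by apply/eigenspaceP; rewrite -mulmxA RE mulmxA uR scalemxAl.
  by apply: contra_neq u0 => /(canRL (mulmxKp (row_base_free V))) ->; rewrite mul0mx.
have WS C : S C -> (W *m C <= W)%MS.
  move=> SC'; rewrite sub_capmx; apply/andP; split.
    by apply: submx_trans (submxMr C (capmxSl _ _)) (VS _ SC').
  apply/eigenspaceP; rewrite -mulmxA (SC _ _ SC' SA) mulmxA.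
  by rewrite (eigenspaceP (capmxSr V (eigenspace A a))) scalemxAl.
have VW : (V <= W)%MS.
  have WV : (W <= V)%MS by apply: capmxSl.
  rewrite -(mxrank_leqif_sup WV); apply/eqP/anti_leq.
  rewrite mxrankS //= Vk; apply: kmin; apply/asboolP; by exists W.
exists a; apply/eigenspaceP; apply: submx_trans wV _; apply: submx_trans VW _.
exact: capmxSr.
Qed.

End CommonEigenvector.

Section Diagonalisation.
Variables (F : closedFieldType) (n : nat).
Local Notation M := ('M[F]_n.+1).
Local Notation G := (PGL F n.+1).

Lemma mulV_nz (A : GL F n.+1) (w : 'rV[F]_n.+1) a : w != 0 -> w *m A = a *: w -> a != 0.
Proof.
move=> w0 wA; apply: contra_neq w0 => a0; move: wA; rewrite a0 scale0r.
by move/(canRL (mulmxK (GLunit A))); rewrite mul0mx.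
Qed.

(* Two lifts commute up to a scalar of order dividing [n.+1]; since a torus is
   divisible, they commute. *)
Lemma lift_commute (A B C : GL F n.+1) :
  toPGL C = (toPGL A ^+ n.+1)%g -> (toPGL A * toPGL B = toPGL B * toPGL A)%g ->
  GLmx C *m B = GLmx B *m C.
Proof.
move=> CA; rewrite -(toPGLM A B) -(toPGLM B A) => /toPGL_lift[d d0 /= AB].
have dn : d ^+ n.+1 = 1.
  have /eqP := congr1 determinant AB; rewrite detZ !det_mulmx [X in _ == _ * X]mulrC.
  rewrite -[X in X == _]mul1r (inj_eq (mulIf _)) => [/eqP <- //|].
  by rewrite mulf_neq0 // -unitfE -unitmxE GLunit.
have pw k : GLmx (A ^+ k)%g *m B = d ^+ k *: (GLmx B *m GLmx (A ^+ k)%g).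
  elim: k => [|k IH]; first by rewrite expr0 scale1r /= mul1mx mulmx1.
  by rewrite expgS /= -mulmxA IH -scalemxAr !mulmxA AB -!scalemxAl scalerA -exprSr.
have powPGL k : toPGL (A ^+ k)%g = (toPGL A ^+ k)%g.
  by elim: k => [//|k IH]; rewrite !expgS toPGLM IH.
rewrite -powPGL in CA; have [c c0 ->] := toPGL_lift CA.
by rewrite -scalemxAl pw dn scale1r scalemxAr.
Qed.

(** Commuting lifts share an eigenvector [w], and rescaling each lift to fix [w] turns the
    projective representation into a linear one, still regular. After clearing denominators it
    expands in monomials; the rows of the coefficient matrices are common left eigenvectors, and
    they span because these matrices sum to the value at 1, the identity. A basis chosen among these
    rows is [B]. *)
Theorem torus_diagonalisable (T : set G) : is_torus T ->
  exists2 B : M, B \in unitmx & T `<=` torus B.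
Proof.
move=> [_ _ [r [phi [phi_bij phiM phi_reg]]]].
pose A x : GL F n.+1 := repr (phi x).
have phiA x : toPGL (A x) = phi x by exact: toPGL_repr.
have phi1 : phi (fun=> 1) = 1%g.
  apply: (mulgI (phi (fun=> 1))); rewrite mulg1 -phiM; try by move=> i; apply: oner_neq0.
  by congr phi; apply/funext => i; rewrite mulr1.
have phiX z k : nonvanishing z -> phi (fun i => z i ^+ k) = (phi z ^+ k)%g.
  move=> z0; elim: k => [|k IH]; first by rewrite expg0 -phi1; congr phi.
  rewrite expgS -IH -phiM // => [|i]; last by rewrite expf_neq0.
  by congr phi; apply/funext => i; rewrite exprS.
have AC x y : nonvanishing x -> nonvanishing y -> A x *m A y = A y *m A x.
  move=> x0 y0; have /choice[z zE] i := closed_field_root (x i) (ltn0Sn n).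
  have z0 : nonvanishing z.
    by move=> i; have := x0 i; rewrite -zE expf_eq0.
  apply: (@lift_commute (A z)); rewrite !phiA.
    by rewrite -phiX //; congr phi; apply/funext => i; rewrite zE.
  by rewrite -!phiM //; congr phi; apply/funext => i; rewrite mulrC.
have [w w0 wA] : exists2 w : 'rV[F]_n.+1, w != 0 &
    forall C, [set GLmx (A x) | x in @nonvanishing F 'I_r] C -> exists a, w *m C = a *: w.
  by apply: common_left_eigenvector => _ _ [x x0 <-] [y y0 <-]; apply: AC.
have [k wk] : exists k, w 0 k != 0.
  apply/not_existsP => H; case/eqP: w0; apply/rowP => k; rewrite mxE.
  by apply/eqP/negP => /negP /H.
have [u wu] : exists u : 'cV[F]_n.+1, (w *m u) 0 0 = 1.
  exists ((w 0 k)^-1 *: delta_mx k 0).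
  rewrite -scalemxAr mxE mxE (bigD1 k) //= mxE !eqxx mulr1 big1 ?addr0 ?mulVf //.
  by move=> j /negbTE jk; rewrite mxE jk mulr0.
(* The multiple of [C] that fixes [w], when [w] is an eigenvector of [C]. *)
pose N (C : M) : M := (w *m invmx C *m u) 0 0 *: C.
have NE (C : GL F n.+1) a : w *m C = a *: w -> N C = a^-1 *: GLmx C.
  move=> wC; have a0 := mulV_nz w0 wC; congr (_ *: _).
  have -> : w *m invmx C = a^-1 *: w.
    by apply: (can_inj (mulmxK (GLunit C))); rewrite mulmxKV ?GLunit // -scalemxAl wC
      scalerA mulVf ?scale1r.
  by rewrite -scalemxAl mxE wu mulr1.
have NZ (C C' : GL F n.+1) : toPGL C = toPGL C' -> N C = N C'.
  move=> /toPGL_lift[c c0 ->]; rewrite /N invmxZ ?unitmxZ ?unitfE ?GLunit //.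
  by rewrite -scalemxAr -scalemxAl mxE scalerA mulrAC mulVf ?mul1r.
pose b x := N (A x).
have bM x y : nonvanishing x -> nonvanishing y -> b (fun i => x i * y i) = b x *m b y.
  move=> x0 y0; have [a aE] := wA _ (ex_intro2 _ _ x x0 erefl).
  have [a' a'E] := wA _ (ex_intro2 _ _ y y0 erefl).
  rewrite /b (NZ _ (A x * A y)%g); last by rewrite toPGLM !phiA phiM.
  have E : w *m (A x * A y)%g = (a * a') *: w.
    by rewrite /= mulmxA aE -scalemxAl a'E scalerA.
  rewrite (NE _ _ E) (NE _ _ aE) (NE _ _ a'E) -scalemxAl -scalemxAr scalerA invfM.
  by rewrite /=.
have b1 : b (fun=> 1) = 1%:M.
  rewrite /b (NZ _ 1%g); last by rewrite phiA phi1.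
  by rewrite /N invmx1 mulmx1 wu scale1r.
have b_lift x : nonvanishing x -> exists2 c, c != 0 & b x = c *: GLmx (A x).
  move=> x0; have [a aE] := wA _ (ex_intro2 _ _ x x0 erefl).
  by exists a^-1; [rewrite invr_eq0 (mulV_nz w0 aE)|apply: NE].
have b_reg i j : exists (p : mpoly #|{: 'I_r}| F) (K : nat), forall x, nonvanishing x ->
    b x i j = peval p (x : affine F 'I_r) / (\prod_i x i) ^+ K.
  pose g (z : G) := N (repr z) i j.
  suff gR : regular_PGL g.
    by have /phi_reg[p [K pE]] : regular_on T g by [exists g]; exists p, K => x /pE.
  have [p pE] : exists p : mpoly #|{: 'I_n.+1 * 'I_n.+1}| F, forall x,
      (w *m \adj (mx_of x) *m u) 0 0 * mx_of x i j = peval p x.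
    apply: peval_polyfun; apply: polyfun_mul; last exact: polymx_mx_of.
    have := polyfun_trace (u *m w) (polymx_adj (@polymx_mx_of F n.+1)).
    by apply: polyfun_ext => x; rewrite -mulmxA mxtrace_mulC -mulmxA /mxtrace big_ord1 mulmxA.
  exists p, 1%N => C; rewrite /g (NZ _ C) ?toPGL_repr // /N mxE expr1.
  rewrite [invmx C]/invmx GLunit -scalemxAr -scalemxAl mxE -mulrA mulrC; congr (_ / _).
  by rewrite -(entriesK C) pE.
clearbody b; clear N NE NZ.
have [Q [K QE]] : exists (Q : 'I_n.+1 -> 'I_n.+1 -> mpoly #|{: 'I_r}| F) K,
    forall x, nonvanishing x -> forall i j,
      (\prod_i x i) ^+ K * b x i j = peval (Q i j) (x : affine F 'I_r).
  have /choice[e /choice[p pE]] (ij : 'I_n.+1 * 'I_n.+1) : exists e p, forall x,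
      nonvanishing x -> b x ij.1 ij.2 = peval p (x : affine F 'I_r) / (\prod_i x i) ^+ e.
    by have [p [e pE]] := b_reg ij.1 ij.2; exists e, p.
  pose K := (\max_ij e ij)%N.
  have /choice[q qE] ij : exists q : mpoly #|{: 'I_r}| F, forall x : 'I_r -> F,
      (\prod_i x i) ^+ (K - e ij) * peval (p ij) (x : affine F 'I_r) = peval q x.
    apply: peval_polyfun; apply: polyfun_mul (polyfun_peval _).
    by apply/polyfun_exp/polyfun_prod => k'; apply: polyfun_var.
  exists (fun i j => q (i, j)), K => x x0 i j; rewrite -qE (pE (i, j) x x0).
  have px : \prod_i x i != 0 by apply/prodf_neq0 => k' _; apply: x0.
  have eK : (e (i, j) <= K)%N by apply: leq_bigmax.
  rewrite -[in LHS](subnK eK) exprD -mulrA; congr (_ * _).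
  rewrite mulrCA mulfV ?mulr1 ?expf_neq0 //.
(* The product of the coordinates is itself a character, so multiplying by its [K]-th power clears
   the denominators and keeps multiplicativity. *)
pose Mm x : M := \matrix_(i, j) peval (Q i j) (x : affine F 'I_r).
have MmE x : nonvanishing x -> Mm x = (\prod_i x i) ^+ K *: b x.
  by move=> x0; apply/matrixP => i j; rewrite [LHS]mxE [RHS]mxE -QE.
have MmM x y : nonvanishing x -> nonvanishing y ->
    Mm (fun i => x i * y i) = Mm x *m Mm y.
  move=> x0 y0; rewrite !MmE ?bM // => [|i]; last exact: mulf_neq0.
  by rewrite -scalemxAl -scalemxAr scalerA -exprMn -big_split.
have Mm1 : Mm (fun=> 1) = 1%:M.
  rewrite MmE => [|i]; last exact: oner_neq0.
  by rewrite big1 // expr1n scale1r b1.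
pose sz := (\max_ij mmeasure mdeg (Q ij.1 ij.2))%N.
pose C (m : multinom #|{: 'I_r}|) : M := \matrix_(i, j) mcoeff m (Q i j).
pose s := [seq bmnm m | m <- index_enum (bmultinom #|{: 'I_r}| sz)].
have us : uniq s by rewrite map_inj_uniq ?index_enum_uniq //; apply: val_inj.
have MmS x : Mm x = \sum_(m <- s) monomial m (x \o enum_val) *: C m.
  apply/matrixP => i j; rewrite mxE summxE /peval.
  rewrite {1}(@mpolywE _ _ sz (Q i j)); last exact: (leq_bigmax (i, j)).
  rewrite raddf_sum big_map; apply: eq_bigr => m _ /=.
  by rewrite mevalZ mevalX !mxE mulrC.
(* Compare the coefficients of [monomial m x] in the multiplicativity of [Mm]. *)
have CM m y : m \in s -> nonvanishing y ->
    C m *m Mm y = monomial m (y \o enum_val) *: C m.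
  move=> ms y0; apply/matrixP => i j; apply/eqP; rewrite -subr_eq0; apply/eqP.
  pose c k' := (C k' *m Mm y) i j - (monomial k' (y \o enum_val) *: C k') i j.
  apply: (@monomials_independent _ _ s c us _ m ms) => x x0.
  pose x1 : 'I_r -> F := x \o enum_rank.
  have x1E : x = x1 \o enum_val by apply/funext => k'; rewrite /x1 /= enum_valK.
  have := MmM x1 y (fun k' => x0 _) y0; rewrite !(MmS (fun i => _ * _)) (MmS x1).
  rewrite mulmx_suml => /matrixP/(_ i j)/esym/eqP; rewrite -subr_eq0 !summxE -sumrB.
  move=> /eqP E; rewrite -[RHS]E; apply: eq_bigr => k' _; rewrite /c.
  have xyE : monomial k' ((fun i => x1 i * y i) \o enum_val) =
      monomial k' x * monomial k' (y \o enum_val) by rewrite -monomialM x1E.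
  rewrite mulrBl; congr (_ - _); first by rewrite -scalemxAl [RHS]mxE mulrC -x1E.
  by rewrite [RHS]mxE xyE [X in X * _]mxE mulrAC [X in X * _]mulrC.
pose I : finType := ('I_(size s) * 'I_n.+1)%type.
pose Ev (ki : I) := row ki.2 (C (nth (@mnm0 #|{: 'I_r}|) s ki.1)).
pose R := \matrix_(a < #|I|) Ev (enum_val a).
have R_full : row_full R.
  rewrite -sub1mx -Mm1 MmS big_seq; apply: summx_sub => m ms; apply: scalemx_sub.
  apply/row_subP => i.
  have mi : (index m s < size s)%N by rewrite index_mem.
  suff -> : row i (C m) = row (enum_rank ((Ordinal mi, i) : I)) R by apply: row_sub.
  by rewrite rowK enum_rankK /Ev /= nth_index.
pose B := rowsub (fullrankfun R_full) R.
have uB : B \in unitmx := fullrowsub_unit R_full.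
exists B => // t Tt; have [_ _ /(_ t Tt)[y y0 <-]] := phi_bij.
pose d := \row_k' monomial (nth (@mnm0 #|{: 'I_r}|) s (enum_val (fullrankfun R_full k')).1) (y \o enum_val).
have BM : B *m Mm y = diag_mx d *m B.
  apply/row_matrixP => k'; rewrite row_mul row_rowsub rowK /Ev -row_mul CM ?mem_nth //.
  have -> : row k' (diag_mx d *m B) = d 0 k' *: row k' B.
    by apply/rowP => l; rewrite mul_diag_mx !mxE.
  by rewrite row_rowsub rowK /Ev mxE linearZ.
have [c c0 bE] := b_lift y y0.
have px : (\prod_i y i) ^+ K != 0 by rewrite expf_neq0 //; apply/prodf_neq0 => k' _; apply: y0.
rewrite -phiA; apply: (@torus_diag _ _ _ uB _ (((\prod_i y i) ^+ K * c)^-1 *: d)).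
have -> : GLmx (A y) = ((\prod_i y i) ^+ K * c)^-1 *: Mm y.
  by rewrite MmE // bE !scalerA -mulrA mulVf ?scale1r // mulf_neq0.
by rewrite -scalemxAr BM linearZ /= scalemxAl.
Qed.

End Diagonalisation.

(** * Genericity *)

Section IndependentExample.
Variables (F : closedFieldType) (n : nat).
Local Notation M := ('M[F]_n.+1).

Lemma sum_dconjE (B : M) (c : 'I_n -> F) :
  \sum_j c j *: dconjE B j =
  invmx B *m diag_mx (\row_k oapp c 0 (unlift ord_max k)) *m B.
Proof.
have -> : diag_mx (\row_k oapp c 0 (unlift ord_max k)) =
    \sum_j c j *: delta_mx (lift ord_max j) (lift ord_max j).
  apply/matrixP => k l; rewrite summxE !mxE; under eq_bigr do rewrite !mxE.
  case: (unliftP ord_max k) => [j ->|->] /=.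
    rewrite (bigD1 j) //= big1 ?addr0; last first.
      by move=> i /negbTE ij; rewrite (inj_eq lift_inj) eq_sym ij mulr0.
    by rewrite eqxx /= mulr_natr [l == _]eq_sym.
  by rewrite mul0rn big1 // => j _; rewrite (negbTE (neq_lift _ _)) mulr0.
rewrite mulmx_sumr mulmx_suml; apply: eq_bigr => j _.
by rewrite -scalemxAr -scalemxAl.
Qed.

(* The diagonal torus and its conjugates by [1 + \sum_(b != k) E_kb], one for
   each row [k]: the conjugate of [E_bb] is [E_bb - E_kb] for [b != k]. *)
Lemma independent_example s : (s <= n.+2)%N ->
  exists B : 'I_s -> M, (forall i, B i \in unitmx) /\
    lin_indep (fun o => oapp (torus_tangent B) 1%:M o).
Proof.
(* Index 0 gives the diagonal torus, as [Y i] is then 0, and an index i > 0 uses row i - 1; one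
   torus plus [n.+1] rows accounts for the bound [n.+2]. *)
move=> sn; pose k (i : 'I_s) : 'I_n.+1 := inord i.-1.
have kE (i : 'I_s) : (0 < i)%N -> k i = i.-1 :> nat.
  by move=> i0; rewrite inordK // prednK // -ltnS (leq_trans _ sn) // ltnS.
pose Y (i : 'I_s) : M := \matrix_(a, b) [&& (0 < i)%N, a == k i & b != k i]%:R.
(* Only row [k i] of [Y i] can be nonzero, and its entry in column [k i] is 0. Hence [1 - Y i]
   inverts [1 + Y i], and conjugating a diagonal D gives D + D Y - Y D. *)
have YDY i d : Y i *m diag_mx d *m Y i = 0.
  apply/matrixP => a b; rewrite mul_mx_diag !mxE big1 // => e _; rewrite !mxE.
  by case: (e == k i); rewrite ?andbF ?mul0r ?mulr0.
have Yinv i : (1%:M - Y i) *m (1%:M + Y i) = 1%:M.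
  have := YDY i (const_mx 1); rewrite diag_const_mx mulmx1 => YY.
  by rewrite mulmxDr mulmx1 mulmxBl mul1mx YY subr0 subrK.
have uB i : 1%:M + Y i \in unitmx by have [] := mulmx1_unit (Yinv i).
have iB i : invmx (1%:M + Y i) = 1%:M - Y i.
  by apply: (can_inj (mulmxK (uB i))); rewrite mulVmx // Yinv.
exists (fun i => 1%:M + Y i); split=> // c; rewrite sum_option /= sum_pair /=.
pose d i a := oapp (fun j => c (Some (i, j))) 0 (unlift ord_max a).
have TE i a b : (\sum_j c (Some (i, j)) *: torus_tangent (fun i => 1%:M + Y i) (i, j)) a b =
    d i a *+ (a == b) + Y i a b * (d i a - d i b).
  transitivity ((invmx (1%:M + Y i) *m diag_mx (\row_a d i a) *m (1%:M + Y i)) a b).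
    by rewrite -(sum_dconjE _ (fun j => c (Some (i, j)))).
  rewrite iB mulmxBl mul1mx mulmxDr mulmx1.
  rewrite mulmxBl YDY subr0 mul_diag_mx mul_mx_diag.
  by move: (Y i) => Z; rewrite !mxE -!/(d i _); ring.
move=> c0.
have E a b : c None *+ (a == b) +
    \sum_i (d i a *+ (a == b) + Y i a b * (d i a - d i b)) = 0.
  move/matrixP/(_ a b): c0; rewrite !mxE summxE mulr_natr; apply: etrans.
  by congr (_ + _); apply: eq_bigr => i _; rewrite TE.
have dmax i : d i ord_max = 0 by rewrite /d unlift_none.
have dpos (i : 'I_s) b : (0 < i)%N -> d i b = 0.
  (* Off the diagonal, row [k i] receives a contribution from torus [i] alone, which forces [d i] to
     be constant; its last entry is 0 by the normalisation in [dvec]. *)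
  move=> i0; suff di b' : b' != k i -> d i b' = d i (k i).
    have dk : d i (k i) = 0.
      by have [<- //|kmax] := eqVneq ord_max (k i); rewrite -(di _ kmax).
    by have [->|/di ->] := eqVneq b (k i).
  move=> bk; have := E (k i) b'; rewrite eq_sym (negbTE bk) mulr0n add0r.
  rewrite (bigD1 i) //= mulr0n add0r big1 => [|j ji]; last first.
    rewrite mulr0n add0r mxE; case: (ltnP 0 j) => j0; last by rewrite mul0r.
    case: eqP => [kij|_]; last by rewrite mul0r.
    case/eqP: ji; apply: val_inj; rewrite /= -(prednK i0) -(prednK j0) -!kE //.
    by rewrite kij.
  by rewrite addr0 mxE i0 eqxx bk mul1r => /eqP; rewrite subr_eq0 => /eqP.
(* The diagonal entries now involve only the scalar coefficient and the diagonal torus; the last one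
   isolates [c None]. *)
have dzero a : c None + \sum_(i < s | i == 0%N :> nat) d i a = 0.
  have := E a a; rewrite eqxx mulr1n; apply: etrans; congr (_ + _).
  rewrite big_mkcond; apply: eq_bigr => i _; rewrite subrr mulr0 addr0 mulr1n.
  by case: eqP => // /eqP; rewrite -lt0n => /dpos->.
have cN : c None = 0.
  by have := dzero ord_max; rewrite big1 ?addr0 // => i _; apply: dmax.
have d0 i a : d i a = 0.
  case: (posnP i) => [i0|/dpos->//]; have := dzero a; rewrite cN add0r.
  rewrite (bigD1 i) ?i0 //= big1 ?addr0 // => j /andP[/eqP j0 /eqP[]].
  by apply: val_inj; rewrite /= j0.
case=> [[i j]|] //; rewrite -[RHS](d0 i (lift ord_max j)) /d liftK //.
Qed.

End IndependentExample.

(** * Independence as an open condition on cosets *)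

Section Genericity.
Variables (F : closedFieldType) (n : nat).
Local Notation M := ('M[F]_n.+1).
Local Notation G := (PGL F n.+1).

Definition trace_gram (J : finType) (L E : J -> M) : 'M[F]_#|J| :=
  \matrix_(a, b) \tr (L (enum_val a) *m E (enum_val b)).

(** Turns independence into the nonvanishing of some polynomial in the entries of [E]. *)
Lemma lin_indep_det (J : finType) (E : J -> M) :
  lin_indep E <-> exists L : J -> M, \det (trace_gram L E) != 0.
Proof.
split=> [/dual_family[L LE]|[L detL] c c0].
  exists L; rewrite (_ : trace_gram L E = 1%:M) ?det1 ?oner_neq0 //.
  by apply/matrixP => a b; rewrite !mxE LE (inj_eq enum_val_inj).
set A := trace_gram L E in detL.
have uA : A \in unitmx by rewrite unitmxE unitfE.
have Ac : A *m \col_(a < #|J|) c (enum_val a) = 0.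
  apply/colP => a; rewrite [RHS]mxE -(mxtrace0 F n.+1) -(mulmx0 _ (L (enum_val a))) -c0.
  rewrite mulmx_sumr linear_sum mxE (reindex (@enum_val J J)) /=; last exact: onW_bij (enum_val_bij J).
  by apply: eq_bigr => b _; rewrite !mxE -scalemxAr mxtraceZ mulrC.
move=> j; have /matrixP/(_ (enum_rank j) 0) : \col_(a < #|J|) c (enum_val a) = 0.
  by rewrite -[LHS](mulKmx uA) Ac mulmx0.
by rewrite !mxE enum_rankK.
Qed.

Lemma lin_indep_scale (J : finType) (E : J -> M) (a : J -> F) :
  (forall j, a j != 0) -> lin_indep E -> lin_indep (fun j => a j *: E j).
Proof.
move=> a0 Ei c c0 j; have /(_ j)/eqP : forall j, c j * a j = 0.
  by apply: Ei; rewrite -[RHS]c0; apply: eq_bigr => i _; rewrite scalerA.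
by rewrite mulf_eq0 (negbTE (a0 j)) orbF => /eqP.
Qed.

Lemma dconjEZ (B : M) a j : B \in unitmx -> a != 0 -> dconjE (a *: B) j = dconjE B j.
Proof.
move=> uB a0; rewrite /dconjE invmxZ ?unitmxZ ?unitfE // -scalemxAr -!scalemxAl.
by rewrite scalerA mulfV // scale1r.
Qed.

Section Normaliser.
Variable T : set G.

Lemma conj_setM x y : conj_set T (x * y)%g = conj_set (conj_set T x) y.
Proof.
rewrite eqEsubset; split=> [_ [t Tt <-]|_ [_ [t Tt <-] <-]].
  by exists (t ^ x)%g; [exists t|rewrite conjgM].
by exists t; rewrite ?conjgM.
Qed.

Lemma normaliser1 : normaliser T 1%g.
Proof.
rewrite /normaliser /= eqEsubset; split=> [_ [t Tt <-]|t Tt]; first by rewrite conjg1.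
by exists t; rewrite ?conjg1.
Qed.

Lemma normaliserM x y : normaliser T x -> normaliser T y -> normaliser T (x * y)%g.
Proof. by rewrite /normaliser /= conj_setM => ->. Qed.

Lemma normaliserV x : normaliser T x -> normaliser T x^-1%g.
Proof.
rewrite /normaliser /= => Nx; have := normaliser1; rewrite /normaliser /=.
by rewrite -(mulgV x) conj_setM Nx.
Qed.

Lemma rcoset_refl g : rcoset (normaliser T) g g.
Proof. by exists 1%g; [exact: normaliser1|rewrite mul1g]. Qed.

Lemma rcosetMl x g : normaliser T x ->
  rcoset (normaliser T) (x * g)%g = rcoset (normaliser T) g.
Proof.
move=> Nx; rewrite eqEsubset; split=> _ [y Ny <-].
  by exists (y * x)%g; [exact: normaliserM|rewrite mulgA].
exists (y * x^-1)%g; first by apply: normaliserM (normaliserV Nx).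
by rewrite -mulgA mulKg.
Qed.

End Normaliser.

Section OpenCondition.
Variables (B : M) (s : nat).
Hypothesis uB : B \in unitmx.

Definition independent_conj (A : 'I_s -> M) :=
  lin_indep (fun o => oapp (torus_tangent (fun i => B *m A i)) 1%:M o).

(* The adjugate clears the denominators of the tangent vectors. *)
Let tangent_adj (A : 'I_s -> M) (o : option ('I_s * 'I_n)) : M :=
  if o is Some (i, j) then
    \adj (B *m A i) *m delta_mx (lift ord_max j) (lift ord_max j) *m (B *m A i)
  else 1%:M.

Lemma independent_conj_adj (A : 'I_s -> M) : (forall i, A i \in unitmx) ->
  independent_conj A <-> lin_indep (tangent_adj A).
Proof.
move=> uA; have uBA i : B *m A i \in unitmx by rewrite unitmx_mul uB uA.
have d0 i : \det (B *m A i) != 0 by rewrite -unitfE -unitmxE.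
pose a (o : option ('I_s * 'I_n)) := if o is Some ij then \det (B *m A ij.1) else 1.
have a0 o : a o != 0 by case: o => [[i j]|] /=; rewrite ?oner_neq0.
have aE o : tangent_adj A o = a o *: oapp (torus_tangent (fun i => B *m A i)) 1%:M o.
  case: o => [[i j]|] /=; last by rewrite scale1r.
  rewrite /torus_tangent /dconjE /= [invmx _]/invmx uBA -!scalemxAl scalerA.
  by rewrite mulfV // scale1r.
split=> [/(lin_indep_scale a0) H|].
  by move=> c c0; apply: H; rewrite -[RHS]c0; apply: eq_bigr => o _; rewrite aE.
have a0' o : (a o)^-1 != 0 by rewrite invr_eq0.
move=> /(lin_indep_scale a0') H c c0; apply: H.
by rewrite -[RHS]c0; apply: eq_bigr => o _; congr (_ *: _); rewrite aE
  scalerA mulVf ?scale1r.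
Qed.

Lemma independent_conjZ (A A' : 'I_s -> GL F n.+1) :
  (forall i, toPGL (A i) = toPGL (A' i)) ->
  independent_conj (fun i => A i) -> independent_conj (fun i => A' i).
Proof.
move=> AA' Ai c c0; apply: Ai; rewrite -[RHS]c0; apply: eq_bigr => -[[i j]|] _ //=.
have [a a0 aE] := toPGL_lift (AA' i).
rewrite /torus_tangent /= aE -scalemxAr dconjEZ // unitmx_mul uB; exact: GLunit.
Qed.

(** The condition concerns cosets, while the coordinates see one representative [A]. Any other is,
    up to scalars, [m i * A i] with [m i] in the normaliser, so the open set is a union of
    nonvanishing loci over all such [m] and all test families [L]. *)
Lemma open_independent_conj (T : set G) :
  open_pow [set g : 'I_s -> G | exists A : 'I_s -> GL F n.+1,
    (forall i, rcoset (normaliser T) (g i) = rcoset (normaliser T) (toPGL (A i))) /\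
    independent_conj (fun i => A i)].
Proof.
pose mx (z : 'I_s * ('I_n.+1 * 'I_n.+1) -> F) i : M := \matrix_(a, b) z (i, (a, b)).
pose f (m : 'I_s -> GL F n.+1) (L : option ('I_s * 'I_n) -> M) z :=
  \det (trace_gram L (tangent_adj (fun i => m i *m mx z i))).
have fP m L : polyfun (f m L).
  apply: polyfun_det => a b.
  apply: (polyfun_ext (f := fun z => \tr (L (enum_val a) *m
    tangent_adj (fun i => m i *m mx z i) (enum_val b)))).
    by move=> z; rewrite mxE.
  apply: polyfun_trace; case: (enum_val b) => [[i j]|] /=; last exact: polymx_cst.
  have mP : polymx (fun z => B *m (m i *m mx z i)).
    apply: polymx_mul (polymx_cst _ _) (polymx_mul (polymx_cst _ _) _) => k l.
    by apply: polyfun_ext (polyfun_var _ (i, (k, l))) => z; rewrite mxE.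
  exact: polymx_mul (polymx_mul (polymx_adj mP) (polymx_cst _ _)) mP.
exists [set z | exists2 h, [set h | exists m L,
    (forall i, normaliser T (toPGL (m i))) /\ h = f m L] h & h z != 0].
  apply/zariski_openP; exists [set h | exists m L,
    (forall i, normaliser T (toPGL (m i))) /\ h = f m L]; split=> // _ [m [L [_ ->]]].
  exact: fP.
move=> A; have mxE' i : mx (fun z => GLentries (A z.1) z.2) i = A i.
  by apply/matrixP => a b; rewrite mxE.
have umA (m : 'I_s -> GL F n.+1) i : m i *m A i \in unitmx.
  by rewrite unitmx_mul !GLunit.
have fE m L : f m L (fun z => GLentries (A z.1) z.2) = 
      \det (trace_gram L (tangent_adj (fun i => m i *m A i))).
  by rewrite /f; under [fun i => m i *m mx _ i]eq_fun do rewrite mxE'.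
split=> [[A' [AA' A'i]]|[_ [m [L [mN ->]]]]].
  have /choice[x xP] i : exists x, normaliser T x /\ toPGL (A' i) = (x * toPGL (A i))%g.
    have := rcoset_refl T (toPGL (A' i)); rewrite -AA' => -[x Nx <-].
    by exists x.
  have mAi : independent_conj (fun i => repr (x i) *m A i).
    apply: (@independent_conjZ A' (fun i => repr (x i) * A i)%g) => // i.
    by have [_ ->] := xP i; rewrite toPGLM toPGL_repr.
  have [|/(_ mAi)/lin_indep_det[L detL] _] := @independent_conj_adj (fun i => repr (x i) *m A i).
    exact: umA.
  exists (f (fun i => repr (x i)) L); last by rewrite fE.
  by exists (fun i => repr (x i)), L; split=> // i; rewrite toPGL_repr; have [] := xP i.
rewrite fE => detL; exists (fun i => m i * A i)%g; split=> [i|].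
  by rewrite toPGLM rcosetMl.
by apply/(independent_conj_adj (umA m))/lin_indep_det; exists L.
Qed.

End OpenCondition.

Lemma maximal_torusE (T : set G) : maximal_torus T ->
  exists2 B : M, B \in unitmx & T = torus B.
Proof.
move=> [T_torus T_max]; have [B uB TB] := torus_diagonalisable T_torus.
by exists B => //; rewrite (T_max _ (is_torus_torus uB) TB).
Qed.

End Genericity.

Theorem corollary1p7 (F : closedFieldType) (n s : nat)
    (hn : (2 <= n)%N) (hs : (1 <= s <= n.+1)%N)
    (T : set (PGL F n)) (hT : maximal_torus T) :
  generic_tori T (fun Ts : 'I_s -> set (PGL F n) =>
    (exists d : 'I_s -> nat,
       (forall i, has_dim (Ts i) (d i)) /\
       has_dim (prod_set Ts) (\sum_(i < s) d i)%N) /\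
    generically (prod_set Ts)
      (fun g => finite_set (decompositions Ts g))).
Proof.
case: n hn hs T hT => [//|n] _ /andP[_ sn] T hT.
have [B uB TE] := maximal_torusE hT; rewrite {hT}TE; set N := normaliser (torus B).
exists [set C | exists A : 'I_s -> GL F n.+1,
  (forall i, C i = rcoset N (toPGL (A i))) /\ independent_conj B (fun i => A i)].
split.
- split; last exact: open_independent_conj.
  by move=> C [A [CA _]] i; exists (toPGL (A i)).
- have [B' [uB' B'i]] := @independent_example F n s sn.
  (* The example conjugates the standard diagonal torus; the factor [invmx B] transports it to
     conjugates of [torus B]. *)
  have uBB i : invmx B *m B' i \in unitmx by rewrite unitmx_mul unitmx_inv uB uB'.
  exists (fun i => rcoset N (toPGL (MkGL (uBB i)))), (fun i => MkGL (uBB i)); split=> //.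
  move=> c c0; apply: B'i; rewrite -[RHS]c0; apply: eq_bigr => -[[i j]|] _ //=.
  by rewrite /torus_tangent /= mulKVmx.
move=> g [A [gA Ai]].
have gE i : conj_set (torus B) (g i) = torus (B *m A i).
  have := rcoset_refl (torus B) (g i); rewrite -/N gA => -[x Nx <-].
  by rewrite conj_setM Nx conj_torus.
have uBA i : B *m A i \in unitmx by rewrite unitmx_mul uB GLunit.
have [[d [dT dprod]] fib] := independent_tori uBA Ai; rewrite (funext gE).
by split=> //; exists d; split=> // i; rewrite gE.
Qed.
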